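(* Let $K$ be a field of characteristic $0$ and let $L/K$ be a Galois extension with $\mathrm{Gal}(L/K)\cong S_3$. Let $\Gamma$ be the quiver of type $D_4$ with vertices $v_0,v_1,v_2,v_3$ and edges $e_i\colon v_0\to v_i$ for $i=1,2,3$, and let $\Gamma_K$ be the $K$-rational quiver given by the action of $\mathrm{Gal}(L/K)\cong S_3$ on $\Gamma$ with $\sigma v_0=v_0$, $\sigma v_i=v_{\sigma(i)}$ and $\sigma e_i=e_{\sigma(i)}$ for $i\in\{1,2,3\}$, $\sigma\in S_3$. Then $\Gamma_K$ has, up to isomorphism, exactly $6$ indecomposable representations over $K$. Each indecomposable corresponds to one of the $6$ Galois orbits of the $12$ positive roots of $D_4$.
   Context: A $K$-rational structure on a quiver $\Gamma=(V,E,s,t)$ with respect to a Galois extension $L/K$ is a homomorphism $\mathrm{Gal}(L/K)\to\mathrm{Aut}(\Gamma)$, with continuous induced actions on $V$ and $E$; the pair is called a $K$-rational quiver $\Gamma_K$. A representation of $\Gamma_K$ over $K$ ($K$-rational representation) consists of $L$-vector spaces $M(v)$, $v\in V$; $\sigma$-linear isomorphisms $\varphi_{v,\sigma}\colon M(v)\to M(\sigma v)$ for $\sigma\in\mathrm{Gal}(L/K)$ with $\varphi_{\tau v,\sigma}\circ\varphi_{v,\tau}=\varphi_{v,\sigma\tau}$; and $L$-linear maps $\phi_e\colon M(s(e))\to M(t(e))$ for $e\in E$ with $\phi_{\sigma e}\circ\varphi_{s(e),\sigma}=\varphi_{t(e),\sigma}\circ\phi_e$. Morphisms are families of $L$-linear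 maps commuting with all $\phi_e$ and $\varphi_{v,\sigma}$. The Galois group acts on the simple roots $\alpha_0,\dots,\alpha_3$ of $D_4$ (with $\alpha_j$ corresponding to $v_j$, so $\alpha_0$ is the central one) by $\sigma\alpha_0=\alpha_0$, $\sigma\alpha_i=\alpha_{\sigma(i)}$ for $i=1,2,3$, extended linearly. Identifying positive roots with dimension vectors $(d_0,d_1,d_2,d_3)$, the six orbits are $\{(1,0,0,0)\}$; $\{(0,1,0,0),(0,0,1,0),(0,0,0,1)\}$; $\{(1,1,0,0),(1,0,1,0),(1,0,0,1)\}$; $\{(1,1,1,0),(1,1,0,1),(1,0,1,1)\}$; $\{(1,1,1,1)\}$; $\{(2,1,1,1)\}$. The indecomposable corresponding to an orbit $\mathcal O$ is the one whose underlying representation of $\Gamma$ over $L$ (forgetting the $\varphi_{v,\sigma}$) is isomorphic to the direct sum, over $\alpha\in\mathcal O$, of the indecomposable representations of $\Gamma$ over $L$ with dimension vector $\alpha$. *)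

(* Defs.v *)
From HB Require Import structures.
From mathcomp Require Import all_boot all_order all_algebra.
From mathcomp Require Import all_fingroup all_solvable all_field.
From mathcomp Require Import zify ring.

Set Implicit Arguments.
Unset Strict Implicit.
Unset Printing Implicit Defensive.

Import GRing.Theory Num.Theory.
Local Open Scope ring_scope.

Record quiver := Quiver {
  vert : finType;
  edge : finType;
  src : edge -> vert;
  tgt : edge -> vert
}.

Definition dimvec (Q : quiver) := {ffun vert Q -> nat}.

Section Representations.
Variables (L : fieldType) (Q : quiver).

(* The vector spaces M(v) are not assumed to be finite-dimensional. *)
Record rep := Rep {
  rep_sp : vert Q -> lmodType L;
  rep_map : forall e, {linear rep_sp (src e) -> rep_sp (tgt e)}
}.

Record rep_hom (M N : rep) := RepHom {
  rep_hom_map :> forall v, {linear rep_sp M v -> rep_sp N v};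
  rep_homP : forall e x,
    rep_hom_map (tgt e) (rep_map M e x) = rep_map N e (rep_hom_map (src e) x)
}.

Definition rep_iso (M N : rep) : Prop :=
  exists (f : rep_hom M N) (g : rep_hom N M),
    forall v, cancel (f v) (g v) /\ cancel (g v) (f v).

Definition rep_zero (M : rep) : Prop := forall v (x : rep_sp M v), x = 0.

Section PairMap.
Variables (U U' W W' : lmodType L).
Variables (f : {linear U -> W}) (g : {linear U' -> W'}).
Definition pair_map (x : U * U') : W * W' := (f x.1, g x.2).
Lemma pair_map_is_linear : linear pair_map.
Proof. by move=> a x y; rewrite /pair_map /= !linearP. Qed.
HB.instance Definition _ :=
  GRing.isLinear.Build L (U * U')%type (W * W')%type *:%R pair_map
    pair_map_is_linear.
End PairMap.

Definition rep_sum (M N : rep) : rep :=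
  @Rep (fun v => (rep_sp M v * rep_sp N v)%type : lmodType L)
       (fun e => pair_map (rep_map M e) (rep_map N e)).

Definition rep0 : rep :=
  @Rep (fun=> 'rV[L]_0 : lmodType L) (fun=> idfun : {linear 'rV[L]_0 -> 'rV[L]_0}).

Definition rep_indec (M : rep) : Prop :=
  ~ rep_zero M /\
  forall A B : rep, rep_iso M (rep_sum A B) -> rep_zero A \/ rep_zero B.

Definition has_dimvec (M : rep) (d : dimvec Q) : Prop :=
  forall v, exists f : {linear 'rV[L]_(d v) -> rep_sp M v}, bijective f.

(* M is "the" indecomposable representation with dimension vector d. *)
Definition the_indec_of_dimvec (d : dimvec Q) (M : rep) : Prop :=
  [/\ rep_indec M, has_dimvec M d &
      forall N, rep_indec N -> has_dimvec N d -> rep_iso N M].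

End Representations.

(* For L : splittingFieldType K, gal_of {:L} is the type of all automorphisms *)
(* of L over K.  Its product is (s * t) a = t (s a), so that a right action   *)
(* in the sense of {action _ &-> _} is a left action with respect to the      *)
(* composition of automorphisms.  As L / K is finite, Gal(L / K) is discrete  *)
(* and the continuity of its actions is automatic.                            *)
Section RationalQuivers.
Variables (K : fieldType) (L : splittingFieldType K).

Lemma gal1_setT : 'Gal({:L} / 1)%g = [set: gal_of {:L}].
Proof.
apply/setP=> x; rewrite inE gal_kHom ?sub1v // k1HomE.
by rewrite ahomWin.
Qed.

Record rquiver := RQuiver {
  rq_quiver :> quiver;
  rq_vact : {action gal_of {:L} &-> vert rq_quiver};
  rq_eact : {action gal_of {:L} &-> edge rq_quiver};
  rq_src : forall e s, src (rq_eact e s) = rq_vact (src e) s;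
  rq_tgt : forall e s, tgt (rq_eact e s) = rq_vact (tgt e) s
}.

Definition sp_cast (Q : quiver) (M : rep L Q) (v w : vert Q) (vw : v = w)
  (x : rep_sp M v) : rep_sp M w := ecast u (rep_sp M u) vw x.

Variable Q : rquiver.

Record krep := KRep {
  krep_rep :> rep L Q;
  krep_sl : forall v s, rep_sp krep_rep v -> rep_sp krep_rep (rq_vact Q v s);
  krep_sl_semilinear : forall v (s : gal_of {:L}) (a : L) (x y : rep_sp krep_rep v),
    krep_sl s (a *: x + y) = s a *: krep_sl s x + krep_sl s y;
  krep_sl_bij : forall v s, bijective (@krep_sl v s);
  (* the composite "s after t" is the product t * s *)
  krep_slM : forall v s t (x : rep_sp krep_rep v),
    sp_cast (esym (actM (rq_vact Q) v t s))
      (krep_sl s (krep_sl t x)) = krep_sl (t * s)%g x;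
  krep_sl_map : forall e s (x : rep_sp krep_rep (src e)),
    rep_map krep_rep (rq_eact Q e s)
      (sp_cast (esym (rq_src e s)) (krep_sl s x))
    = sp_cast (esym (rq_tgt e s)) (krep_sl s (rep_map krep_rep e x))
}.

Arguments krep_sl M {v} s x : rename.

Record krep_hom (M N : krep) := KRepHom {
  krep_hom_map :> rep_hom M N;
  krep_homP : forall v s x,
    krep_hom_map (rq_vact Q v s) (krep_sl M s x)
    = krep_sl N s (krep_hom_map v x)
}.

Definition krep_iso (M N : krep) : Prop :=
  exists (f : krep_hom M N) (g : krep_hom N M),
    forall v, cancel (f v) (g v) /\ cancel (g v) (f v).

Section Sum.
Variables M N : krep.

Definition krep_sum_sl v s (x : rep_sp (rep_sum M N) v) :
    rep_sp (rep_sum M N) (rq_vact Q v s) :=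
  (krep_sl M s x.1, krep_sl N s x.2).

Lemma sp_cast_sum v w (vw : v = w) (x : rep_sp M v) (y : rep_sp N v) :
  @sp_cast Q (rep_sum M N) v w vw (x, y) = (sp_cast vw x, sp_cast vw y).
Proof. by case: w / vw. Qed.

Lemma krep_sum_semilinear v (s : gal_of {:L}) (a : L) x y :
  @krep_sum_sl v s (a *: x + y)
  = s a *: @krep_sum_sl v s x + @krep_sum_sl v s y.
Proof. by rewrite /krep_sum_sl /= !krep_sl_semilinear. Qed.

Lemma krep_sum_bij v s : bijective (@krep_sum_sl v s).
Proof.
have [f fK Kf] := krep_sl_bij M v s; have [g gK Kg] := krep_sl_bij N v s.
exists (fun x => (f x.1, g x.2)) => -[x y]; rewrite /krep_sum_sl /=.
  by rewrite fK gK.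
by rewrite Kf Kg.
Qed.

Lemma krep_sum_slM v s t x :
  sp_cast (esym (actM (rq_vact Q) v t s))
    (krep_sum_sl s (@krep_sum_sl v t x)) = krep_sum_sl (t * s)%g x.
Proof. by rewrite sp_cast_sum !krep_slM. Qed.

Lemma krep_sum_map e s x :
  rep_map (rep_sum M N) (rq_eact Q e s)
    (sp_cast (esym (rq_src e s)) (@krep_sum_sl (src e) s x))
  = sp_cast (esym (rq_tgt e s)) (krep_sum_sl s (rep_map (rep_sum M N) e x)).
Proof. by rewrite !sp_cast_sum /= /pair_map /= !krep_sl_map. Qed.

Definition krep_sum : krep :=
  KRep krep_sum_semilinear krep_sum_bij krep_sum_slM krep_sum_map.
End Sum.

Definition krep_indec (M : krep) : Prop :=
  ~ rep_zero M /\
  forall A B : krep, krep_iso M (krep_sum A B) -> rep_zero A \/ rep_zero B.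

End RationalQuivers.

(* None is the central vertex v_0; Some 0, Some 1, Some 2 are v_1, v_2, v_3,  *)
(* and the edge i goes from v_0 to Some i.                                    *)
Definition D4 : quiver :=
  @Quiver (option 'I_3) 'I_3 (fun=> None) (fun i => Some i).

Section RationalD4.
Variables (K : fieldType) (L : splittingFieldType K).
Variable iota : {morphism 'Gal({:L} / 1)%g >-> 'S_3}.

Definition D4_eactf (i : 'I_3) (s : gal_of {:L}) : 'I_3 := iota s i.
Definition D4_vactf (v : option 'I_3) (s : gal_of {:L}) : option 'I_3 :=
  omap (iota s) v.

Lemma iota1 : iota 1%g = 1%g. Proof. exact: morph1. Qed.
Lemma iotaM s t : iota (s * t)%g = (iota s * iota t)%g.
Proof. by rewrite morphM // gal1_setT inE. Qed.

Lemma D4_eact1 : D4_eactf^~ 1%g =1 id.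
Proof. by move=> i; rewrite /D4_eactf iota1 perm1. Qed.
Lemma D4_eactM i : act_morph D4_eactf i.
Proof. by move=> s t; rewrite /D4_eactf iotaM permM. Qed.
Lemma D4_vact1 : D4_vactf^~ 1%g =1 id.
Proof. by case=> //= i; rewrite iota1 perm1. Qed.
Lemma D4_vactM v : act_morph D4_vactf v.
Proof. by case: v => [i|] s t; rewrite /D4_vactf /= ?iotaM ?permM. Qed.

Definition D4_eact : {action gal_of {:L} &-> edge D4} :=
  TotalAction D4_eact1 D4_eactM.
Definition D4_vact : {action gal_of {:L} &-> vert D4} :=
  TotalAction D4_vact1 D4_vactM.

Definition D4_K : rquiver L :=
  @RQuiver K L D4 D4_vact D4_eact (fun _ _ => erefl) (fun _ _ => erefl).
End RationalD4.

(* Coordinates of a root in the basis alpha_0, ..., alpha_3. *)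
Definition D4vec (d0 d1 d2 d3 : nat) : dimvec D4 :=
  [ffun v : option 'I_3 => if v is Some i then nth 0%N [:: d1; d2; d3] i else d0].

Definition D4_posroots : seq (dimvec D4) :=
  [:: D4vec 1 0 0 0;
      D4vec 0 1 0 0; D4vec 0 0 1 0; D4vec 0 0 0 1;
      D4vec 1 1 0 0; D4vec 1 0 1 0; D4vec 1 0 0 1;
      D4vec 1 1 1 0; D4vec 1 1 0 1; D4vec 1 0 1 1;
      D4vec 1 1 1 1;
      D4vec 2 1 1 1].

Definition tits (Q : quiver) (d : dimvec Q) : int :=
  \sum_(v : vert Q) (d v * d v)%N%:Z - \sum_(e : edge Q) (d (src e) * d (tgt e))%N%:Z.

Lemma D4vecE (d : dimvec D4) :
  d = D4vec (d None) (d (Some 0)) (d (Some 1)) (d (Some 2%:R)).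
Proof.
apply/ffunP=> -[i|]; rewrite ffunE //.
by case: i => -[|[|[|//]]] lti /=; congr (d (Some _)); apply/val_inj.
Qed.

Lemma sum_vertD4 (F : vert D4 -> int) :
  \sum_v F v = F None + F (Some 0) + F (Some 1) + F (Some 2%:R).
Proof.
rewrite (bigD1 None) //= -!addrA; congr (_ + _).
rewrite (reindex_omap (Some : 'I_3 -> vert D4) id) /=; last by case.
rewrite (eq_bigl xpredT) => [|i]; last by rewrite eqxx.
rewrite !big_ord_recl big_ord0 addr0; congr (F (Some _) + (F (Some _) + F (Some _)));
  exact/val_inj.
Qed.

Lemma titsD4 a b c d : tits (D4vec a b c d) =
  (a * a + b * b + c * c + d * d)%N%:Z - (a * b + a * c + a * d)%N%:Z.
Proof.
rewrite /tits sum_vertD4 /= !big_ord_recl big_ord0 !ffunE /=; lia.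
Qed.

(* The positive roots are the vectors in the positive cone at which the Tits  *)
(* form of D4 takes the value 1.                                              *)
Lemma mem_D4_posroots (d : dimvec D4) : (d \in D4_posroots) = (tits d == 1).
Proof.
rewrite (D4vecE d); move: (d None) (d (Some 0)) (d (Some 1)) (d (Some 2%:R)) => a b c e.
rewrite titsD4; apply/idP/eqP => [|q1].
  rewrite !inE.
  by do 11?[case/orP]; move=> /eqP/ffunP h;
     have := (h None, h (Some 0), h (Some 1), h (Some 2%:R));
     rewrite !ffunE /= => -[[[-> ->] ->] ->].
have sq (x y : nat) : ((2 * x%:Z - y%:Z) * (2 * x%:Z - y%:Z) >= 0)%R
  by rewrite -expr2 sqr_ge0.
have E : (2 * b%:Z - a%:Z) * (2 * b%:Z - a%:Z) + (2 * c%:Z - a%:Z) * (2 * c%:Z - a%:Z)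
   + (2 * e%:Z - a%:Z) * (2 * e%:Z - a%:Z) + a%:Z * a%:Z = 4%:Z.
  by have /= := congr1 (fun z => 4%:Z * z) q1; rewrite mulr1 => <-; rewrite !PoszD !PoszM; ring.
have := (sq b a, sq c a, sq e a) => -[[sb sc] se].
have a2 : (a <= 2)%N by nia.
have b2 : (b <= 2)%N.
  rewrite leqNgt; apply/negP=> b3; have h : (4%:Z <= 2 * b%:Z - a%:Z)%R by lia.
  nia.
have c2 : (c <= 2)%N.
  rewrite leqNgt; apply/negP=> c3; have h : (4%:Z <= 2 * c%:Z - a%:Z)%R by lia.
  nia.
have e2 : (e <= 2)%N.
  rewrite leqNgt; apply/negP=> e3; have h : (4%:Z <= 2 * e%:Z - a%:Z)%R by lia.
  nia.
clear -q1 a2 b2 c2 e2; rewrite !inE.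
by case: a a2 q1 => [|[|[|//]]] _; case: b b2 => [|[|[|//]]] _;
   case: c c2 => [|[|[|//]]] _; case: e e2 => [|[|[|//]]] _ //= _;
   rewrite !eqxx ?orbT.
Qed.

Definition posroot := seq_sub D4_posroots.

Section GaloisOnRoots.
Variables (K : fieldType) (L : splittingFieldType K).
Variable iota : {morphism 'Gal({:L} / 1)%g >-> 'S_3}.

(* s (sum_v d_v alpha_v) = sum_v d_v alpha_(s v), whose coordinate at v is    *)
(* d_(s^-1 v).                                                                *)
Definition dimvec_actf (d : dimvec D4) (s : gal_of {:L}) : dimvec D4 :=
  [ffun v => d (D4_vact iota v s^-1%g)].

Lemma tits_actf d s : tits (dimvec_actf d s) = tits d.
Proof.
rewrite /tits; congr (_ - _).
  rewrite [RHS](reindex_inj (act_inj (D4_vact iota) s^-1%g)).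
  by apply: eq_bigr => v _; rewrite ffunE.
rewrite [RHS](reindex_inj (act_inj (D4_eact iota) s^-1%g)).
by apply: eq_bigr => v _; rewrite !ffunE.
Qed.

Lemma dimvec_actf_root d s :
  d \in D4_posroots -> dimvec_actf d s \in D4_posroots.
Proof. by rewrite !mem_D4_posroots tits_actf. Qed.

Definition posroot_actf (r : posroot) (s : gal_of {:L}) : posroot :=
  SeqSub (dimvec_actf_root s (ssvalP r)).

Lemma posroot_act1 : posroot_actf^~ 1%g =1 id.
Proof.
by move=> r; apply/val_inj/ffunP=> v; rewrite ffunE invg1 act1.
Qed.
Lemma posroot_actM r : act_morph posroot_actf r.
Proof.
by move=> s t; apply/val_inj/ffunP=> v; rewrite !ffunE invMg actM.
Qed.

Definition posroot_act : {action gal_of {:L} &-> posroot} :=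
  TotalAction posroot_act1 posroot_actM.

Definition root_orbits : {set {set posroot}} :=
  [set orbit posroot_act 'Gal({:L} / 1)%g r | r : posroot].

Definition corresponds (M : krep (D4_K iota)) (O : {set posroot}) : Prop :=
  exists N : posroot -> rep L D4,
    (forall r, r \in O -> the_indec_of_dimvec (val r) (N r)) /\
    rep_iso M (\big[@rep_sum L D4/rep0 L D4]_(r in O) N r).

End GaloisOnRoots.

(* Main.v *)
Require Import Defs.
From mathcomp Require Import all_boot all_order all_algebra.
From mathcomp Require Import all_fingroup all_solvable all_field.
From HB Require Import structures.
From mathcomp Require Import zify ring.
From mathcomp Require boolp classical_sets.

(* Over L, every nonzero representation M of the quiver, of any dimension,    *)
(* has a direct summand among twelve explicit representations N_r, one for    *)
(* each positive root r.  Since the endomorphisms of N_r are the scalars, the *)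
(* N_r are exactly the indecomposables over L.  For an orbit O of roots,      *)
(* X_O = (+)_(r in O) N_r carries an evident rational structure, and a        *)
(* nonzero rational endomorphism of X_O is invertible: it is diagonal, with   *)
(* conjugate entries.  If M is rational and N_r splits off M over L, there    *)
(* are L-linear maps X_O -> M -> X_O with nonzero composite.  By Artin's      *)
(* independence of characters the traces of suitable multiples of these maps  *)
(* are rational and still have a nonzero, hence invertible, composite; so X_O *)
(* splits off M over K.                                                       *)

Set Implicit Arguments.
Unset Strict Implicit.
Unset Printing Implicit Defensive.

Import GRing.Theory.
Local Open Scope ring_scope.

(** * Linear algebra in arbitrary dimension *)

(** The whole classification rests on finding a root summand over L in any dimension
    ([root_summand_exists]). Let f_i be the edge maps of M and K_i their kernels. If some f_i is not
    onto, a vector outside its image spans a simple summand at leaf i. Otherwise, if some x lies in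
    every K_i with i outside S but not in the sum of the K_i with i in S, then x generates a summand
    with central dimension 1 and leaves S. In the remaining case any two of the K_i are
    complementary in the centre, and vectors x_i of K_i with sum zero, not all zero, generate a
    summand of dimension vector (2,1,1,1). Each retraction comes from a functional supplied by
    Zorn's lemma ([separating_functional]).

    Homomorphisms between the root representations are computed by hand: endomorphisms are scalars
    ([root_endo_scalar]), and distinct roots of one orbit admit only zero maps
    ([root_hom_orbit_zero]). Hence [orbit_krep_brick]: a nonzero rational endomorphism of an orbit
    sum is invertible. Descent is [krep_brick_retract], which gives completeness in
    [krep_indec_orbit]; [orbit_krep_iso] separates the orbits, and [orbit_typeP] counts them. *)

Section LinearAlgebra.
Variables (L : fieldType) (V : lmodType L).

Definition mk_linear (U : lmodType L) (f : U -> V) (fL : linear f) :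
  {linear U -> V} := HB.pack f (GRing.isLinear.Build L U V *:%R f fL).

Definition mk_scalar (f : V -> L) (fL : scalar f) :
  {scalar V} := HB.pack f (GRing.isLinear.Build L V L *%R f fL).

Definition subspace (P : V -> Prop) :=
  P 0 /\ forall a x y, P x -> P y -> P (a *: x + y).

Lemma subspaceZ P a x : subspace P -> P x -> P (a *: x).
Proof. by move=> [P0 PZ] Px; rewrite -[_ *: _]addr0; apply: PZ. Qed.

Lemma subspaceB P x y : subspace P -> P x -> P y -> P (x - y).
Proof. by move=> sP Px Py; rewrite addrC -scaleN1r; apply: sP.2. Qed.

(** Allows a functional to be defined by a relation: linearity of [R] turns uniqueness of the value
    at 0 into uniqueness everywhere, and into linearity of any choice of values. *)
Lemma scalar_of_graph (R : V -> L -> Prop) :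
    (forall x, exists c, R x c) -> (forall c, R 0 c -> c = 0) ->
    (forall a x y c d, R x c -> R y d -> R (a *: x + y) (a * c + d)) ->
  exists l : {scalar V}, forall x, R x (l x).
Proof.
move=> Rtot R0 RL; have [l Rl] := boolp.choice Rtot.
have lL : scalar l.
  move=> a x y; apply/eqP; rewrite -subr_eq0; apply/eqP/R0.
  have := RL (-1) _ _ _ _ (RL a _ _ _ _ (Rl x) (Rl y)) (Rl (a *: x + y)).
  by rewrite scaleN1r addNr mulN1r [X in R _ X]addrC.
by exists (mk_scalar lL).
Qed.

(** By Zorn, [H] is maximal among the subspaces that contain [W] and avoid [x]; for [y] outside [H],
    the span of [H] and [y] must therefore contain [x]. *)
Lemma maximal_avoiding_subspace (W : V -> Prop) (x : V) :
  subspace W -> ~ W x ->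
  exists H, [/\ subspace H, ~ H x, forall y, W y -> H y &
    forall y, ~ H y -> exists a h, H h /\ x = a *: y + h].
Proof.
move=> sW nWx.
pose T := {H : V -> Prop | [/\ subspace H, ~ H x & forall y, W y -> H y]}.
pose R (A B : T) := boolp.asbool (forall y, sval A y -> sval B y).
have [|||C RC|[H [sH nHx WH]] Hmax] := @classical_sets.Zorn T R.
- by move=> A; apply/boolp.asboolP.
- move=> A B C /boolp.asboolP AB /boolp.asboolP BC.
  by apply/boolp.asboolP=> y /AB /BC.
- move=> [A hA] [B hB] /boolp.asboolP/= AB /boolp.asboolP/= BA.
  have E : A = B by apply/boolp.funext=> y; apply/boolp.propext; split; auto.
  by case: B / E hB {AB BA} => hB; congr exist; apply: boolp.Prop_irrelevance.
(* The empty chain is bounded by [W] itself, a nonempty one by its union. *)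
- have [[A0 CA0]|nC] := boolp.pselect (exists A, C A); last first.
    exists (exist _ W (And3 sW nWx (fun y (Wy : W y) => Wy))) => A CA.
    by case: nC; exists A.
  pose U y := exists2 A : T, C A & sval A y.
  have hU : [/\ subspace U, ~ U x & forall y, W y -> U y].
    split; first split.
    + by exists A0 => //; case: (svalP A0) => -[].
    + move=> a y z [A CA Ay] [B CB Bz].
      have [/boolp.asboolP AB|/boolp.asboolP BA] := RC _ _ CA CB.
        by exists B => //; case: (svalP B) => -[_ BZ] _ _; apply: BZ => //; apply: AB.
      by exists A => //; case: (svalP A) => -[_ AZ] _ _; apply: AZ => //; apply: BA.
    + by move=> [A _]; case: (svalP A).
    + by move=> y Wy; exists A0 => //; case: (svalP A0) => _ _; apply.
  by exists (exist _ U hU) => A CA; apply/boolp.asboolP=> y Ay; exists A.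
exists H; split=> // y nHy; apply: boolp.contrapT => nxy.
pose H' z := exists a h, H h /\ z = a *: y + h.
have sub z : H z -> H' z by exists 0, z; rewrite scale0r add0r.
have hH' : [/\ subspace H', ~ H' x & forall y, W y -> H' y].
  split=> [||z /WH/sub//]; last by move=> [a [h [Hh E]]]; apply: nxy; exists a, h.
  split=> [|a _ _ [b [h [Hh ->]]] [c [k [Hk ->]]]]; first exact/sub/sH.1.
  exists (a * b + c), (a *: h + k); split; first exact: sH.2.
  by rewrite scalerDr scalerA scalerDl addrACA.
have /(congr1 sval)/= E : exist _ H' hH' = exist _ H (And3 sH nHx WH) :> T.
  by apply: Hmax; apply/boolp.asboolP => z /sub.
apply: nHy; rewrite -E; exists 1, 0; split; first exact: sH.1.
by rewrite scale1r addr0.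
Qed.

(** With [H] as above, V is the direct sum of [H] and the line of [x]; [l] is the coordinate along
    [x]. *)
Lemma separating_functional (W : V -> Prop) (x : V) :
    subspace W -> ~ W x ->
  exists l : {scalar V}, l x = 1 /\ forall y, W y -> l y = 0.
Proof.
move=> sW /(maximal_avoiding_subspace sW)[H [sH nHx WH Hx]].
have Hscale c : H (c *: x) -> c = 0.
  move=> Hcx; apply: boolp.contrapT => /eqP c0; apply: nHx.
  by rewrite -[x]scale1r -(mulVf c0) -scalerA; apply: subspaceZ.
have [y|c|a y z c d|l lP] := @scalar_of_graph (fun y c => H (y - c *: x)).
- have [Hy|nHy] := boolp.pselect (H y); first by exists 0; rewrite scale0r subr0.
  have [a [h [Hh E]]] := Hx _ nHy.
  have a0 : a != 0.
    by apply/eqP=> a0; apply: nHx; rewrite E a0 scale0r add0r.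
  exists a^-1; rewrite {1}E scalerDr scalerA mulVf // scale1r opprD addrA subrr.
  by rewrite add0r -scaleNr; apply: subspaceZ.
- by rewrite sub0r -scaleNr => /Hscale/eqP; rewrite oppr_eq0 => /eqP.
- move=> Hy Hz.
  rewrite (_ : _ - _ = a *: (y - c *: x) + (z - d *: x)); first exact: sH.2.
  by rewrite scalerBr scalerA scalerDl opprD addrACA.
have Hl c y : H (y - c *: x) -> l y = c.
  move=> /(subspaceB sH (lP y)); rewrite opprB addrC addrA subrK -scalerBl.
  by move=> /Hscale/eqP; rewrite subr_eq0 => /eqP.
exists l; split; first by apply: Hl; rewrite scale1r subrr; apply: sH.1.
by move=> y Wy; apply: Hl; rewrite scale0r subr0; apply: WH.
Qed.

Lemma functional_at (x : V) : x <> 0 -> exists l : {scalar V}, l x = 1.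
Proof.
move=> x0; have [||l [lx _]] := @separating_functional (fun y => y = 0) x => //.
  by split=> // a y z -> ->; rewrite scaler0 addr0.
by exists l.
Qed.

End LinearAlgebra.

Section Kernel.
Variables (L : fieldType) (V W : lmodType L).

Lemma kernel_subspace (f : {linear V -> W}) : subspace (fun x => f x = 0).
Proof.
by split=> [|a x y fx fy]; rewrite ?linear0 // linearP fx fy scaler0 addr0.
Qed.

Lemma bijective_linear (f : {linear V -> W}) :
  bijective f -> exists g : {linear W -> V}, cancel f g /\ cancel g f.
Proof.
move=> [g fK gK]; have gL : linear g.
  by move=> a x y; apply: (can_inj fK); rewrite linearP !gK.
by exists (mk_linear gL).
Qed.

(** Used to carry functionals from the centre to the leaves along surjective edge maps. *)
Lemma factor_functional (f : {linear V -> W}) (m : {scalar V}) :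
    (forall y, exists x, f x = y) -> (forall x, f x = 0 -> m x = 0) ->
  exists l : {scalar W}, forall x, l (f x) = m x.
Proof.
move=> fS fm.
have fm' x x' : f x = f x' -> m x = m x'.
  by move=> E; apply/eqP; rewrite -subr_eq0 -linearB fm // linearB E subrr.
have [y|c|a y z c d|l lP] :=
    @scalar_of_graph _ W (fun y c => exists2 x, f x = y & m x = c).
- by have [x] := fS y; exists (m x), x.
- by case=> x /fm ->.
- by case=> x <- <- [x' <- <-]; exists (a *: x + x'); rewrite linearP.
by exists l => x; have [x' /fm' -> ->] := lP (f x).
Qed.

End Kernel.

Section SubModule.
Variables (L : fieldType) (V : lmodType L) (S : submodClosed V).

(** Subspaces must be modules in their own right, since a representation places an [lmodType] at
    each vertex. *)
Record submod := SubMod { submod_val :> V; submod_valP : submod_val \in S }.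

HB.instance Definition _ := [isSub for submod_val].
HB.instance Definition _ := [Choice of submod by <:].
HB.instance Definition _ := [SubChoice_isSubLmodule of submod by <:].

End SubModule.

Section KernelType.
Variables (L : fieldType) (V W : lmodType L) (f : {linear V -> W}).

Definition kerp : {pred V} := fun x => f x == 0.
Lemma kerp_closed : submod_closed kerp.
Proof.
split=> [|a x y]; rewrite !unfold_in ?linear0 //.
by move=> /eqP fx /eqP fy; rewrite linearP fx fy scaler0 addr0.
Qed.
HB.instance Definition _ := GRing.isSubmodClosed.Build L V kerp kerp_closed.
End KernelType.

Definition kernel (L : fieldType) (V W : lmodType L) (f : {linear V -> W}) :=
  submod (kerp f : submodClosed V).

(** * Representations of quivers *)

Section Reps.
Variables (L : fieldType) (Q : quiver).
Implicit Types M N X Y A B : rep L Q.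

Lemma rep_id_subproof M e (x : rep_sp M (src e)) :
  (idfun : {linear _ -> _}) (rep_map M e x)
  = rep_map M e ((idfun : {linear _ -> _}) x).
Proof. by []. Qed.
Definition rep_id M : rep_hom M M :=
  @RepHom _ _ M M (fun v => idfun : {linear rep_sp M v -> rep_sp M v})
    (@rep_id_subproof M).

Lemma rep_comp_subproof M N X (g : rep_hom N X) (f : rep_hom M N) e
    (x : rep_sp M (src e)) :
  (g (tgt e) \o f (tgt e) : {linear _ -> _}) (rep_map M e x)
  = rep_map X e ((g (src e) \o f (src e) : {linear _ -> _}) x).
Proof. by rewrite /= !rep_homP. Qed.
Definition rep_comp M N X (g : rep_hom N X) (f : rep_hom M N) : rep_hom M X :=
  @RepHom _ _ M X (fun v => g v \o f v : {linear _ -> _})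
    (rep_comp_subproof g f).

Lemma rep_hom_inv M N (f : rep_hom M N) : (forall v, bijective (f v)) ->
  exists g : rep_hom N M, forall v, cancel (f v) (g v) /\ cancel (g v) (f v).
Proof.
move=> fbij; pose g v := boolp.cid (bijective_linear (fbij v)).
have gP v : cancel (f v) (sval (g v)) /\ cancel (sval (g v)) (f v) := svalP (g v).
have gh e x : sval (g (tgt e)) (rep_map N e x) = rep_map M e (sval (g (src e)) x).
  by rewrite -{1}[x](gP _).2 -rep_homP (gP _).1.
by exists (@RepHom _ _ N M (fun v => sval (g v)) gh).
Qed.

Lemma rep_iso_bij M N (f : rep_hom M N) :
  (forall v, bijective (f v)) -> rep_iso M N.
Proof. by move=> /rep_hom_inv[g fg]; exists f, g. Qed.

Lemma rep_fst_subproof M N e (x : rep_sp (rep_sum M N) (src e)) :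
  (fst : {linear (_ * _)%type -> _}) (rep_map (rep_sum M N) e x)
  = rep_map M e ((fst : {linear (_ * _)%type -> _}) x).
Proof. by []. Qed.
Definition rep_fst M N : rep_hom (rep_sum M N) M :=
  @RepHom _ _ (rep_sum M N) M (fun v => fst : {linear (_ * _)%type -> _})
    (@rep_fst_subproof M N).

Section Pairing.
Variables (M N X : rep L Q) (f : rep_hom X M) (g : rep_hom X N).
Definition pairing v (x : rep_sp X v) : rep_sp (rep_sum M N) v := (f v x, g v x).
Lemma pairing_linear v : linear (@pairing v).
Proof. by move=> a x y; rewrite /pairing !linearP. Qed.
Lemma pairing_map e x :
  mk_linear (@pairing_linear (tgt e)) (rep_map X e x)
  = rep_map (rep_sum M N) e (mk_linear (@pairing_linear (src e)) x).
Proof. by rewrite /= /pairing /= /pair_map /= !rep_homP. Qed.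
Definition rep_pair : rep_hom X (rep_sum M N) :=
  @RepHom _ _ X (rep_sum M N) (fun v => mk_linear (@pairing_linear v)) pairing_map.
End Pairing.

Section Copairing.
Variables (M N X : rep L Q) (f : rep_hom M X) (g : rep_hom N X).
Definition copairing v (x : rep_sp (rep_sum M N) v) : rep_sp X v :=
  f v x.1 + g v x.2.
Lemma copairing_linear v : linear (@copairing v).
Proof.
by move=> a x y; rewrite /copairing /= !linearP scalerDr addrACA.
Qed.
Lemma copairing_map e x :
  mk_linear (@copairing_linear (tgt e)) (rep_map (rep_sum M N) e x)
  = rep_map X e (mk_linear (@copairing_linear (src e)) x).
Proof. by rewrite /= /copairing /= linearD !rep_homP. Qed.
Definition rep_copair : rep_hom (rep_sum M N) X :=
  @RepHom _ _ (rep_sum M N) X (fun v => mk_linear (@copairing_linear v))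
    copairing_map.
End Copairing.

Lemma rep_zero_subproof M N e (x : rep_sp M (src e)) :
  (\0 : {linear _ -> _}) (rep_map M e x)
  = rep_map N e ((\0 : {linear _ -> _}) x).
Proof. by rewrite /= linear0. Qed.
Definition rep_hom0 M N : rep_hom M N :=
  @RepHom _ _ M N (fun v => \0 : {linear _ -> _}) (@rep_zero_subproof M N).

Section KernelRep.
Variables (M X : rep L Q) (p : rep_hom M X).
Lemma ker_map_subproof e (x : kernel (p (src e))) :
  rep_map M e (val x) \in kerp (p (tgt e)).
Proof.
by case: x => x /= /eqP px; apply/eqP; rewrite rep_homP px linear0.
Qed.
Definition ker_map e (x : kernel (p (src e))) : kernel (p (tgt e)) :=
  SubMod (ker_map_subproof x).
Lemma ker_map_linear e : linear (@ker_map e).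
Proof. by move=> a x y; apply/val_inj; rewrite /= linearP. Qed.
Definition rep_ker : rep L Q :=
  @Rep L Q (fun v => kernel (p v) : lmodType L)
    (fun e => mk_linear (@ker_map_linear e)).
End KernelRep.

(** * Splitting off a retract *)

Section Splitting.
Variables (M X : rep L Q) (i : rep_hom X M) (p : rep_hom M X).
Hypothesis pK : forall v, cancel (i v) (p v).

Lemma split_ker_subproof v (x : rep_sp M v) : x - i v (p v x) \in kerp (p v).
Proof. by apply/eqP; rewrite linearB pK subrr. Qed.
Definition split_map v (x : rep_sp M v) : rep_sp (rep_sum X (rep_ker p)) v :=
  (p v x, SubMod (split_ker_subproof x)).
Lemma split_linear v : linear (@split_map v).
Proof.
move=> a x y; congr (_, _); first exact: linearP.
by apply/val_inj; rewrite /= (linearP (p v)) (linearP (i v)) opprD addrACA scalerBr.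
Qed.
Lemma split_homP e x :
  mk_linear (@split_linear (tgt e)) (rep_map M e x)
  = rep_map (rep_sum X (rep_ker p)) e (mk_linear (@split_linear (src e)) x).
Proof.
congr (_, _); first exact: rep_homP.
by apply/val_inj; rewrite /= linearB !rep_homP.
Qed.
Definition split_hom : rep_hom M (rep_sum X (rep_ker p)) :=
  @RepHom _ _ M (rep_sum X (rep_ker p)) (fun v => mk_linear (@split_linear v))
    split_homP.

Lemma split_bij v : bijective (split_hom v).
Proof.
exists (fun y => i v y.1 + submod_val y.2) => [x|[x [y ky]]] /=.
  by rewrite addrC subrK.
have py : p v y = 0 by apply/eqP; exact: ky.
congr (_, _); first by rewrite linearD pK py addr0.
by apply/val_inj; rewrite /= linearD pK py addr0 addrAC subrr add0r.
Qed.

Lemma retract_bij : rep_zero (rep_ker p) -> forall v, bijective (p v).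
Proof.
move=> K0 v; exists (i v) => // x.
have /(congr1 val)/eqP := K0 v (SubMod (split_ker_subproof x)).
by rewrite /= subr_eq0 => /eqP <-.
Qed.
End Splitting.

(** M is the sum of X and the kernel of [p]; as X is nonzero, indecomposability kills the kernel. *)
Lemma indec_retract M X (i : rep_hom X M) (p : rep_hom M X) :
    (forall v, cancel (i v) (p v)) -> rep_indec M -> ~ rep_zero X ->
  rep_iso M X.
Proof.
move=> pK [_ Mi] X0.
have [//|K0] := Mi _ _ (rep_iso_bij (split_bij pK)).
exact/rep_iso_bij/retract_bij.
Qed.

(** * Bricks are indecomposable *)

Definition nonzero_hom M N (f : rep_hom M N) := exists v x, f v x <> 0.

Definition rep_brick X :=
  forall f : rep_hom X X, nonzero_hom f -> forall v, bijective (f v).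

(** For mutually inverse [f] and [g], the idempotent of M with image A and kernel B. *)
Definition sum_projector M A B (f : rep_hom M (rep_sum A B))
    (g : rep_hom (rep_sum A B) M) : rep_hom M M :=
  rep_comp g (rep_comp (rep_pair (rep_id A) (rep_hom0 A B))
                       (rep_comp (rep_fst A B) f)).

(** An idempotent that is bijective has zero kernel, and one that vanishes has zero image. Only this
    one endomorphism is tested, so the lemma serves over L and over K alike. *)
Lemma sum_projector_zero M A B (f : rep_hom M (rep_sum A B))
    (g : rep_hom (rep_sum A B) M) :
    (forall v, cancel (f v) (g v) /\ cancel (g v) (f v)) ->
    (nonzero_hom (sum_projector f g) -> forall v, bijective (sum_projector f g v)) ->
  rep_zero A \/ rep_zero B.
Proof.
move=> fg fbij.
have [/fbij{}fbij|f0] := boolp.pselect (nonzero_hom (sum_projector f g)).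
  right=> v b; have [_ gK] := fg v.
  have : g v (0, b) = 0.
    by apply: (bij_inj (fbij v)); rewrite [RHS]linear0 /= gK; apply: linear0.
  by move=> /(congr1 (f v)); rewrite gK linear0 => -[].
left=> v a; have [_ gK] := fg v; apply: boolp.contrapT => a0; apply: f0.
exists v, (g v (a, 0)); rewrite /= gK /pairing /= => /(congr1 (f v)).
by rewrite gK linear0 => -[].
Qed.

Lemma brick_indec X : ~ rep_zero X -> rep_brick X -> rep_indec X.
Proof.
move=> X0 Xb; split=> // A B [f [g fg]].
exact: sum_projector_zero fg (Xb _).
Qed.

Lemma bij_rV_eq (m n : nat) (f : {linear 'rV[L]_m -> 'rV[L]_n}) :
  bijective f -> m = n.
Proof.
move=> /bijective_linear[g [fK gK]].
have leq_dim k l (h : {linear 'rV[L]_k -> 'rV[L]_l}) : injective h -> (k <= l)%N.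
  move=> hI; have /eqP <- : row_free (lin1_mx h); last exact: rank_leq_col.
  rewrite -kermx_eq0; apply/eqP/row_matrixP=> j; apply: hI.
  by rewrite -mul_rV_lin1 -row_mul mulmx_ker !row0 linear0.
by apply/eqP; rewrite eqn_leq (leq_dim _ _ _ (can_inj fK)) (leq_dim _ _ _ (can_inj gK)).
Qed.

Lemma has_dimvec_iso M N d d' :
  rep_iso M N -> has_dimvec M d -> has_dimvec N d' -> d = d'.
Proof.
move=> [f [g fg]] Md Nd; apply/ffunP=> v.
have [h hb] := Md v; have [k /bijective_linear[k' [kK k'K]]] := Nd v.
apply: (@bij_rV_eq _ _ (k' \o (f v \o h) : {linear _ -> _})) => /=.
apply: bij_comp; first by exists k.
by apply: bij_comp hb; have [? ?] := fg v; exists (g v).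
Qed.

End Reps.

(** * Rational representations and descent by traces *)

Section RationalReps.
Variables (K : fieldType) (L : splittingFieldType K) (Q : rquiver L).
Implicit Types (M N X : krep Q) (s t : gal_of {:L}).

Lemma galTM s t (a : L) : (s * t)%g a = t (s a).
Proof. by rewrite galM ?memvf. Qed.

Lemma galT1 (a : L) : (1%g : gal_of {:L}) a = a.
Proof. by rewrite gal_id. Qed.

Lemma galTK s (a : L) : s (s^-1%g a) = a.
Proof. by rewrite -galTM mulVg galT1. Qed.

(** A functional nonzero at [y s] reduces this to Artin's independence of characters. *)
Lemma gal_independent_vect (V : lmodType L) (y : gal_of {:L} -> V) s :
  y s <> 0 -> exists a : L, \sum_(t : gal_of {:L}) t a *: y t <> 0.
Proof.
move=> /functional_at[l ls].
have ls0 : l (y s) != 0 by rewrite ls oner_neq0.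
have [a _ /eqP Ha] :=
  @gal_independent_contra K L {:L} xpredT (fun t => l (y t)) s isT ls0.
exists a => /(congr1 l); rewrite linear0 linear_sum => Hl; apply: Ha.
by rewrite -[RHS]Hl; apply: eq_bigr => t _; rewrite linearZ /= mulrC.
Qed.

(* The semilinear maps of a rational representation, with the target vertex   *)
(* known only up to a provable equality.                                      *)
Definition slc M s v w (h : rq_vact Q v s = w) (x : rep_sp M v) : rep_sp M w :=
  sp_cast h (krep_sl s x).

Lemma sp_cast_id M v (h : v = v) (x : rep_sp M v) : sp_cast h x = x.
Proof. by rewrite /sp_cast (eq_axiomK h). Qed.

Lemma slcE M s v (h : rq_vact Q v s = rq_vact Q v s) (x : rep_sp M v) :
  slc h x = krep_sl s x.
Proof. exact: sp_cast_id. Qed.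

Lemma slc_semilinear M s v w (h : rq_vact Q v s = w) a (x y : rep_sp M v) :
  slc h (a *: x + y) = s a *: slc h x + slc h y.
Proof. by case: w / h; rewrite !slcE krep_sl_semilinear. Qed.

Lemma slc0 M s v w (h : rq_vact Q v s = w) : slc h (0 : rep_sp M v) = 0.
Proof.
have := slc_semilinear h (-1) (0 : rep_sp M v) 0.
by rewrite scaler0 addr0 rmorphN1 scaleN1r addNr.
Qed.

Lemma slcZ M s v w (h : rq_vact Q v s = w) a (x : rep_sp M v) :
  slc h (a *: x) = s a *: slc h x.
Proof. by rewrite -[a *: x]addr0 slc_semilinear slc0 addr0. Qed.

Lemma slcD M s v w (h : rq_vact Q v s = w) (x y : rep_sp M v) :
  slc h (x + y) = slc h x + slc h y.
Proof. by rewrite -{1}[x]scale1r slc_semilinear rmorph1 scale1r. Qed.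

Lemma krep_sl0 M v s : krep_sl s (0 : rep_sp M v) = 0.
Proof. by rewrite -(slcE (erefl _)) slc0. Qed.

Lemma krep_slB M v s (x y : rep_sp M v) :
  krep_sl s (x - y) = krep_sl s x - krep_sl s y.
Proof.
rewrite -scaleN1r addrC krep_sl_semilinear rmorphN1 scaleN1r.
exact: addrC.
Qed.

Lemma slc_bij M s v w (h : rq_vact Q v s = w) :
  bijective (slc h : rep_sp M v -> rep_sp M w).
Proof.
case: w / h; have [g gK Kg] := krep_sl_bij M v s.
by exists g => x; rewrite slcE ?gK ?Kg.
Qed.

Lemma slc_comp M s t v w u (h : rq_vact Q v t = w) (h' : rq_vact Q w s = u)
    (h'' : rq_vact Q v (t * s)%g = u) (x : rep_sp M v) :
  slc h' (slc h x) = slc h'' x.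
Proof.
case: w / h h' => h'; rewrite slcE.
case: u / h'' h' => h'; rewrite slcE -krep_slM /slc.
by congr sp_cast; apply: eq_irrelevance.
Qed.

Lemma slc_eq M s t v w (h : rq_vact Q v s = w) (h' : rq_vact Q v t = w)
    (x : rep_sp M v) : s = t -> slc h x = slc h' x.
Proof. by move=> E; case: t / E h' => h'; congr slc; apply: eq_irrelevance. Qed.

Lemma slc1 M v (h : rq_vact Q v 1%g = v) (x : rep_sp M v) : slc h x = x.
Proof.
have h2 : rq_vact Q v (1 * 1)%g = v by rewrite mulg1.
apply: (bij_inj (slc_bij M h)); rewrite (slc_comp _ _ h2).
exact: slc_eq (mulg1 _).
Qed.

Lemma slc_map M s e e' (he : rq_eact Q e s = e')
    (hs : rq_vact Q (src e) s = src e') (ht : rq_vact Q (tgt e) s = tgt e')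
    (x : rep_sp M (src e)) :
  rep_map M e' (slc hs x) = slc ht (rep_map M e x).
Proof.
case: e' / he hs ht => hs ht.
by rewrite /slc (eq_irrelevance hs (esym (rq_src e s)))
  (eq_irrelevance ht (esym (rq_tgt e s))) krep_sl_map.
Qed.

Lemma slcVK M s v (x : rep_sp M v) :
  slc (actKV (rq_vact Q) s v) (slc (erefl (rq_vact Q v s^-1%g)) x) = x.
Proof.
have h : rq_vact Q v (s^-1 * s)%g = v by rewrite mulVg act1.
rewrite (slc_comp _ _ h) (slc_eq _ (act1 _ v)) ?slc1 //.
exact: mulVg.
Qed.

(** * Galois conjugates and traces of an L-linear homomorphism *)

Section Conjugation.
Variables (M N : krep Q) (u : rep_hom M N).

Definition conj_map s v (x : rep_sp M v) : rep_sp N v :=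
  slc (actKV (rq_vact Q) s v) (u _ (slc (erefl (rq_vact Q v s^-1%g)) x)).

(** The intertwining relation that characterises the conjugate s u s^-1; the later identities follow
    from it without unfolding transports. *)
Lemma conj_map_slc s v w (h : rq_vact Q v s = w) (x : rep_sp M v) :
  conj_map s (slc h x) = slc h (u v x).
Proof.
rewrite /conj_map.
(* The intermediate vertex becomes a variable, so that its equality with [v] can be eliminated. *)
suff gen v' (h1 : rq_vact Q w s^-1%g = v') (h2 : rq_vact Q v' s = w) :
  slc h2 (u v' (slc h1 (slc h x))) = slc h (u v x) by exact: gen.
have E : v = v' by rewrite -h1 -h actK.
case: v' / E h1 h2 => h1 h2.
have h3 : rq_vact Q v (s * s^-1)%g = v by rewrite mulgV act1.
rewrite (slc_comp h h1 h3) (slc_eq h3 (act1 _ v)) ?mulgV // slc1.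
by congr slc; apply: eq_irrelevance.
Qed.

Lemma conj_map_linear s v : linear (@conj_map s v).
Proof.
by move=> a x y; rewrite /conj_map slc_semilinear linearP slc_semilinear galTK.
Qed.

Lemma conj_map_map s e (x : rep_sp M (src e)) :
  conj_map s (rep_map M e x) = rep_map N e (conj_map s x).
Proof.
pose e' := rq_eact Q e s^-1%g.
have he : rq_eact Q e' s = e by rewrite actKV.
have hs : rq_vact Q (src e') s = src e by rewrite -rq_src he.
have ht : rq_vact Q (tgt e') s = tgt e by rewrite -rq_tgt he.
have [y ->] : exists y, x = slc hs y.
  by have [g _ gK] := slc_bij M hs; exists (g x).
by rewrite (slc_map he hs ht) !conj_map_slc rep_homP (slc_map he hs ht).
Qed.

Lemma slc_conj_map s t v w (h : rq_vact Q v t = w) (x : rep_sp M v) :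
  slc h (conj_map s x) = conj_map (s * t)%g (slc h x).
Proof.
rewrite -[x in RHS](slcVK s).
have h' : rq_vact Q (rq_vact Q v s^-1%g) (s * t)%g = w by rewrite actM actKV.
by rewrite (slc_comp _ _ h') [slc h _](slc_comp _ _ h') conj_map_slc.
Qed.

Lemma conj_map1 v (x : rep_sp M v) : conj_map 1%g x = u v x.
Proof.
by have := conj_map_slc (act1 (rq_vact Q) v) x; rewrite !slc1.
Qed.

Variable a : L.

Definition trace_map v (x : rep_sp M v) : rep_sp N v :=
  \sum_(s : gal_of {:L}) s a *: conj_map s x.

Lemma trace_map_linear v : linear (@trace_map v).
Proof.
move=> b x y; rewrite /trace_map scaler_sumr -big_split; apply: eq_bigr => s _.
by rewrite conj_map_linear scalerDr !scalerA mulrC.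
Qed.

Lemma trace_map_map e (x : rep_sp M (src e)) :
  mk_linear (@trace_map_linear (tgt e)) (rep_map M e x)
  = rep_map N e (mk_linear (@trace_map_linear (src e)) x).
Proof.
rewrite /= /trace_map linear_sum; apply: eq_bigr => s _.
by rewrite linearZ /= conj_map_map.
Qed.

Definition trace_rep_hom : rep_hom M N :=
  @RepHom _ _ M N (fun v => mk_linear (@trace_map_linear v)) trace_map_map.

(** The trace is the sum of all conjugates of [a *: u]; conjugating by [s] only permutes its
    terms. *)
Lemma trace_map_sl v s (x : rep_sp M v) :
  trace_rep_hom (rq_vact Q v s) (krep_sl s x) = krep_sl s (trace_rep_hom v x).
Proof.
rewrite -!(slcE (erefl _)) /= /trace_map.
rewrite [RHS](big_morph _ (slcD (erefl _)) (slc0 _ (erefl _))).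
rewrite (reindex_inj (mulIg s)); apply: eq_bigr => t _.
by rewrite slcZ galTM slc_conj_map.
Qed.

Definition trace_hom : krep_hom M N :=
  @KRepHom _ _ _ M N trace_rep_hom trace_map_sl.

Lemma trace_homE v (x : rep_sp M v) :
  trace_hom v x = \sum_(s : gal_of {:L}) s a *: conj_map s x.
Proof. by []. Qed.

End Conjugation.

Lemma krep_comp_subproof M N X (g : krep_hom N X) (f : krep_hom M N) v s
    (x : rep_sp M v) :
  rep_comp g f (rq_vact Q v s) (krep_sl s x) = krep_sl s (rep_comp g f v x).
Proof. by rewrite /= !krep_homP. Qed.
Definition krep_comp M N X (g : krep_hom N X) (f : krep_hom M N) :
  krep_hom M X := KRepHom (krep_comp_subproof g f).

Lemma krep_hom_inv M N (f : krep_hom M N) : (forall v, bijective (f v)) ->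
  exists g : krep_hom N M, forall v, cancel (f v) (g v) /\ cancel (g v) (f v).
Proof.
move=> /rep_hom_inv[g fg].
have gh v s (x : rep_sp N v) :
    g (rq_vact Q v s) (krep_sl s x) = krep_sl s (g v x).
  by rewrite -{1}[x](fg _).2 -krep_homP (fg _).1.
by exists (KRepHom gh).
Qed.

Lemma krep_iso_bij M N (f : krep_hom M N) :
  (forall v, bijective (f v)) -> krep_iso M N.
Proof. by move=> /krep_hom_inv[g fg]; exists f, g. Qed.

Section KernelKRep.
Variables (M X : krep Q) (p : krep_hom M X).

Lemma ker_sl_subproof v s (x : kernel (p v)) :
  krep_sl s (submod_val x) \in kerp (p (rq_vact Q v s)).
Proof.
case: x => x /= /eqP px; apply/eqP; by rewrite krep_homP px krep_sl0.
Qed.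
Definition ker_sl v s (x : rep_sp (rep_ker p) v) :
  rep_sp (rep_ker p) (rq_vact Q v s) := SubMod (ker_sl_subproof s x).

Lemma ker_sl_semilinear v s a (x y : rep_sp (rep_ker p) v) :
  ker_sl s (a *: x + y) = s a *: ker_sl s x + ker_sl s y.
Proof. by apply/val_inj; rewrite /= krep_sl_semilinear. Qed.

Lemma sp_cast_ker v w (h : v = w) (x : rep_sp (rep_ker p) v) :
  submod_val (sp_cast h x) = sp_cast h (submod_val x).
Proof. by case: w / h. Qed.

Lemma ker_sl_bij v s : bijective (@ker_sl v s).
Proof.
have [g gK Kg] := krep_sl_bij M v s.
have [h hK Kh] := krep_sl_bij X v s.
have kg (y : kernel (p (rq_vact Q v s))) : g (submod_val y) \in kerp (p v).
  case: y => y /= /eqP py; apply/eqP; apply: (can_inj hK).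
  by rewrite -krep_homP Kg py krep_sl0.
by exists (fun y => SubMod (kg y)) => x; apply/val_inj; rewrite /= ?gK ?Kg.
Qed.

Lemma ker_slM v s t (x : rep_sp (rep_ker p) v) :
  sp_cast (esym (actM (rq_vact Q) v t s)) (ker_sl s (ker_sl t x))
  = ker_sl (t * s)%g x.
Proof. by apply/val_inj; rewrite /= sp_cast_ker krep_slM. Qed.

Lemma ker_sl_map e s (x : rep_sp (rep_ker p) (src e)) :
  rep_map (rep_ker p) (rq_eact Q e s) (sp_cast (esym (rq_src e s)) (ker_sl s x))
  = sp_cast (esym (rq_tgt e s)) (ker_sl s (rep_map (rep_ker p) e x)).
Proof. by apply/val_inj; rewrite /= !sp_cast_ker krep_sl_map. Qed.

Definition krep_ker : krep Q :=
  KRep ker_sl_semilinear ker_sl_bij ker_slM ker_sl_map.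
End KernelKRep.

Lemma krep_indec_retract M X (i : krep_hom X M) (p : krep_hom M X) :
    (forall v, cancel (i v) (p v)) -> krep_indec M -> ~ rep_zero X ->
  krep_iso M X.
Proof.
move=> pK [_ Mi] X0.
have split_sl v s (x : rep_sp M v) :
    split_hom pK (rq_vact Q v s) (krep_sl s x)
    = krep_sl (k := krep_sum X (krep_ker p)) s (split_hom pK v x).
  congr (_, _); first exact: krep_homP.
  by apply/val_inj; rewrite /= !krep_homP krep_slB.
have [//|K0] := Mi X (krep_ker p) (krep_iso_bij
  (f := @KRepHom _ _ _ M (krep_sum X (krep_ker p)) _ split_sl) (split_bij pK)).
exact/krep_iso_bij/(retract_bij pK).
Qed.

Definition krep_brick X :=
  forall f : krep_hom X X, nonzero_hom f -> forall v, bijective (f v).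

Lemma krep_brick_indec X : ~ rep_zero X -> krep_brick X -> krep_indec X.
Proof.
move=> X0 Xb; split=> // A B [f [g fg]]; apply: (sum_projector_zero fg).
have proj_sl v s (x : rep_sp X v) :
    sum_projector f g (rq_vact Q v s) (krep_sl s x)
    = krep_sl s (sum_projector f g v x).
  rewrite /= (krep_homP f) -[RHS](krep_homP g); apply: (congr1 (g _)).
  by congr (_, _); rewrite krep_sl0.
exact: (Xb (KRepHom proj_sl)).
Qed.

(** Replacing [u] and [w] by traces of suitable multiples makes both rational and keeps the
    composite nonzero. The brick property then makes the composite invertible, so X is a rational
    retract of M. *)
Lemma krep_brick_retract M X (u : rep_hom X M) (w : rep_hom M X) :
    krep_brick X -> krep_indec M -> ~ rep_zero X ->
    nonzero_hom (rep_comp w u) -> krep_iso M X.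
Proof.
move=> Xb Mi X0 [v [x wux]].
(* The conjugate by the identity is [u], so the term at 1 is the nonzero vector w(u(x)). *)
have [|a wgx] := @gal_independent_vect _ (fun s => w v (conj_map u s x)) 1%g.
  by rewrite conj_map1.
pose g := trace_hom u a.
have {}wgx : w v (g v x) <> 0.
  move=> E; apply: wgx; rewrite -[RHS]E trace_homE linear_sum.
  by apply: eq_bigr => s _; rewrite linearZ.
have [|b hgx] := @gal_independent_vect _ (fun s => conj_map w s (g v x)) 1%g.
  by rewrite conj_map1.
pose h := trace_hom w b.
have hg : nonzero_hom (krep_comp h g) by exists v, x.
(* With [k] inverse to h g, the map k h is a rational retraction of [g]. *)
have [k kP] := krep_hom_inv (Xb _ hg).
by apply: (krep_indec_retract (i := g) (p := krep_comp k h)) => // z; apply: (kP z).1.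
Qed.

End RationalReps.

(** * The indecomposables attached to the positive roots *)

Lemma ord3_ind (P : 'I_3 -> Prop) : P 0 -> P 1 -> P 2%:R -> forall i, P i.
Proof.
move=> P0 P1 P2 [[|[|[|//]]] lti].
- by rewrite (_ : Ordinal lti = 0) //; apply/val_inj.
- by rewrite (_ : Ordinal lti = 1) //; apply/val_inj.
- by rewrite (_ : Ordinal lti = 2%:R) //; apply/val_inj.
Qed.

Lemma sum_ord3 (V : nmodType) (F : 'I_3 -> V) :
  \sum_i F i = F 0 + F 1 + F 2%:R.
Proof.
rewrite !big_ord_recl big_ord0 addr0 addrA.
by congr (_ + F _ + F _); apply/val_inj.
Qed.

(** These three shapes correspond to the three forms of the central space in [root_space], so later
    arguments treat three cases instead of twelve. *)
Lemma D4_posroots_cases (d : dimvec D4) : d \in D4_posroots ->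
  [\/ exists i, d = [ffun v => (v == Some i) : nat],
      d None = 1%N /\ (forall i, (d (Some i) <= 1)%N)
    | d None = 2%N /\ (forall i, d (Some i) = 1%N)].
Proof.
rewrite !inE; do 11?[case/orP]; move=> /eqP->;
  try (by constructor 2; split; [|apply: ord3_ind]; rewrite !ffunE);
  try (by constructor 3; split; [|apply: ord3_ind]; rewrite !ffunE);
  constructor 1; [exists 0|exists 1|exists 2%:R]; apply/ffunP=> -[i|];
  by rewrite !ffunE //; move: i; apply: ord3_ind.
Qed.

Lemma simple_root_mem (i : 'I_3) :
  [ffun v : vert D4 => (v == Some i) : nat] \in D4_posroots.
Proof.
rewrite mem_D4_posroots (D4vecE [ffun _ => _]) titsD4 !ffunE /=.
by case: i => [[|[|[|//]]] lti].
Qed.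

Lemma center1_root_mem (d : dimvec D4) :
  d None = 1%N -> (forall i, (d (Some i) <= 1)%N) -> d \in D4_posroots.
Proof.
move=> d0 d1; rewrite mem_D4_posroots (D4vecE d) titsD4 d0.
by case: (d _) (d1 0) => [|[|//]] _; case: (d _) (d1 1) => [|[|//]] _;
   case: (d _) (d1 2%:R) => [|[|//]] _.
Qed.

Lemma center2_root_mem (d : dimvec D4) :
  d None = 2%N -> (forall i, d (Some i) = 1%N) -> d \in D4_posroots.
Proof. by move=> d0 d1; rewrite mem_D4_posroots (D4vecE d) titsD4 d0 !d1. Qed.

Section RootReps.
Variable L : fieldType.

Local Notation E := {ffun 'I_3 -> L^o}.

Lemma scaleoE (a : L) (x : L^o) : a *: x = a * x. Proof. by []. Qed.

(* The indecomposable with dimension vector d, realised inside L^3 at each    *)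
(* vertex so as to be stable under the permutation of coordinates: constant   *)
(* (d_0 = 1) or sum-zero (d_0 = 2) vectors at the centre, and vectors         *)
(* supported at i at the i-th leaf.                                           *)
Definition root_space (d : dimvec D4) (v : vert D4) : {pred E} := fun c =>
  match v with
  | None => match d None with
            | 0%N => c == 0
            | 1%N => [forall i, forall j, c i == c j]
            | _ => \sum_i c i == 0
            end
  | Some i => [forall j, ((j == i) && (d (Some i) != 0%N)) || (c j == 0)]
  end.

Lemma root_space_closed d v : submod_closed (root_space d v).
Proof.
split=> [|a x y]; rewrite !unfold_in /root_space.
  case: v => [i|]; first by apply/forallP=> j; rewrite ffunE eqxx orbT.
  case: (d None) => [|[|n]]; first exact: eqxx.
    by apply/forallP=> i; apply/forallP=> j; rewrite !ffunE.
  by rewrite big1 // => i _; rewrite ffunE.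
case: v => [i|].
  move=> /forallP xP /forallP yP; apply/forallP=> j; rewrite !ffunE.
  have := (xP j, yP j); case: (_ && _) => //= -[/eqP-> /eqP->].
  by rewrite scaler0 addr0.
case: (d None) => [|[|n]].
- by move=> /eqP-> /eqP->; rewrite scaler0 addr0.
- move=> /forallP xP /forallP yP; apply/forallP=> i; apply/forallP=> j.
  have := (forallP (xP i) j, forallP (yP i) j).
  by rewrite !ffunE => -[/eqP-> /eqP->].
- move=> /eqP xP /eqP yP.
  rewrite -[X in X == 0](_ : a *: \sum_i x i + \sum_i y i = _).
    by rewrite xP yP scaler0 addr0.
  by rewrite scaler_sumr -big_split; apply: eq_bigr => i _; rewrite !ffunE.
Qed.
HB.instance Definition _ d v :=
  GRing.isSubmodClosed.Build L E (root_space d v) (root_space_closed d v).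

Definition root_sp d v := submod (root_space d v : submodClosed E).

Lemma root_sp_leaf d i (x : root_sp d (Some i)) j :
  (j != i) || (d (Some i) == 0%N) -> submod_val x j = 0.
Proof.
case: x => x /= /forallP/(_ j).
by case: (j == i); case: (d (Some i) == 0%N) => //= /eqP.
Qed.

Lemma root_sp_center0 d (x : root_sp d None) : d None = 0%N -> x = 0.
Proof.
move=> d0; apply/val_inj; case: x => x /=.
by rewrite !unfold_in /root_space d0 => /eqP.
Qed.

Lemma root_sp_center1 d (x : root_sp d None) i j :
  d None = 1%N -> submod_val x i = submod_val x j.
Proof.
move=> d0; case: x => x /=.
by rewrite !unfold_in /root_space d0 => /forallP/(_ i)/forallP/(_ j)/eqP.
Qed.

Lemma root_sp_center2 d (x : root_sp d None) :
  d None = 2%N -> \sum_i submod_val x i = 0.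
Proof.
by move=> d0; case: x => x /=; rewrite !unfold_in /root_space d0 => /eqP.
Qed.

Definition leaf_restr (d : dimvec D4) i (c : E) : E :=
  [ffun j => if (j == i) && (d (Some i) != 0%N) then c j else 0].

Lemma leaf_restr_mem d i c : leaf_restr d i c \in root_space d (Some i).
Proof. by apply/forallP=> j; rewrite ffunE; case: ifP => _ /=. Qed.

Definition root_map d (i : edge D4) (x : root_sp d (src i)) : root_sp d (tgt i) :=
  SubMod (leaf_restr_mem d i (submod_val x)).

Lemma root_map_linear d i : linear (@root_map d i).
Proof.
move=> a x y; apply/val_inj/ffunP=> j; rewrite !ffunE /=.
by case: ifP => _; rewrite ?ffunE // scaler0 addr0.
Qed.

Definition root_rep d : rep L D4 :=
  @Rep L D4 (fun v => root_sp d v : lmodType L)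
    (fun e => mk_linear (@root_map_linear d e)).

Lemma dim_submod (S : submodClosed E) n (F : {linear 'rV[L]_n -> E})
    (G : E -> 'rV[L]_n) :
    (forall u, F u \in S) -> cancel F G -> {in S, cancel G F} ->
  exists f : {linear 'rV[L]_n -> submod S}, bijective f.
Proof.
move=> FS FK GK; pose f u := SubMod (FS u).
have fL : linear f by move=> a x y; apply/val_inj; rewrite /= linearP.
exists (mk_linear fL); exists (fun x => G (submod_val x)) => [u|[x xS]] /=.
  exact: FK.
by apply/val_inj; rewrite /= GK.
Qed.

Lemma root_rep_dimvec d : d \in D4_posroots -> has_dimvec (root_rep d) d.
Proof.
move=> /D4_posroots_cases dP [i|] /=.
  have [d0|d1] : d (Some i) = 0%N \/ d (Some i) = 1%N.
    case: dP => [[j ->]|[_ /(_ i)]|[_ ->]]; last by right.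
      by rewrite ffunE; case: eqP; [right|left].
    by case: (d _) => [|[|//]]; [left|right].
  - rewrite d0; apply: (@dim_submod _ _ (\0 : {linear _ -> _}) (fun=> 0)) => /=.
    + by move=> u; apply: rpred0.
    + by move=> u; rewrite [u]thinmx0.
    + move=> x /forallP xP; apply/ffunP=> j; rewrite ffunE.
      by have := xP j; rewrite d0 andbF /= => /eqP.
  - rewrite d1; pose F (u : 'rV[L]_1) : E := [ffun j => if j == i then u 0 0 else 0].
    have FL : linear F.
      move=> a x y; apply/ffunP=> j; rewrite !ffunE !mxE.
      by case: ifP => // _; rewrite scaler0 addr0.
    apply: (@dim_submod _ _ (mk_linear FL) (fun c => const_mx (c i))) => /=.
    + move=> u; apply/forallP=> j; rewrite ffunE d1 andbT.
      by case: ifP => //= _; rewrite eqxx.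
    + by move=> u; apply/rowP=> j; rewrite mxE ffunE eqxx [j]ord1.
    + move=> x /forallP xP; apply/ffunP=> j; rewrite ffunE mxE.
      by have := xP j; case: eqP => [-> _|_ /= /eqP].
have [d0|d0|d0] : [\/ d None = 0%N, d None = 1%N | d None = 2%N].
  case: dP => [[j ->]|[-> _]|[-> _]]; last by constructor 3.
    by constructor 1; rewrite ffunE.
  by constructor 2.
- rewrite d0; apply: (@dim_submod _ _ (\0 : {linear _ -> _}) (fun=> 0)) => /=.
  + by move=> u; apply: rpred0.
  + by move=> u; rewrite [u]thinmx0.
  + by move=> x; rewrite !unfold_in /root_space d0 => /eqP.
- rewrite d0; pose F (u : 'rV[L]_1) : E := [ffun j => u 0 0].
  have FL : linear F by move=> a x y; apply/ffunP=> j; rewrite !ffunE !mxE.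
  apply: (@dim_submod _ _ (mk_linear FL) (fun c => const_mx (c 0))) => /=.
  + move=> u; rewrite !unfold_in /root_space d0.
    by apply/forallP=> i; apply/forallP=> j; rewrite !ffunE.
  + by move=> u; apply/rowP=> j; rewrite mxE ffunE [j]ord1.
  + move=> x; rewrite !unfold_in /root_space d0 => /forallP/(_ 0)/forallP xP.
    by apply/ffunP=> j; rewrite ffunE mxE; apply/eqP.
(* Sum-zero vectors are parametrised by their first two coordinates. *)
- rewrite d0; pose F (u : 'rV[L]_2) : E :=
    [ffun j : 'I_3 => nth 0 [:: u 0 0; u 0 1; - u 0 0 - u 0 1] j].
  have FL : linear F.
    move=> a x y; apply/ffunP=> -[[|[|[|//]]] ltj]; rewrite !ffunE /= !mxE //.
    by rewrite scalerDr !scalerN !opprD addrACA.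
  apply: (@dim_submod _ _ (mk_linear FL)
    (fun c => \row_(j < 2) c (widen_ord (leqnSn 2) j))) => /=.
  + move=> u; rewrite !unfold_in /root_space d0 !big_ord_recl big_ord0 !ffunE /=.
    by rewrite addr0 addrA -opprD subrr.
  + by move=> u; apply/rowP=> -[[|[|//]] ltj]; rewrite mxE ffunE /=;
      congr (u 0 _); apply/val_inj.
  + move=> x; rewrite !unfold_in /root_space d0 !big_ord_recl big_ord0 addr0.
    move=> /eqP xP; apply/ffunP=> -[[|[|[|//]]] ltj]; rewrite !ffunE /= ?mxE.
    * by congr (x _); apply/val_inj.
    * by congr (x _); apply/val_inj.
    * apply/eqP; rewrite -subr_eq0 -opprD -opprD oppr_eq0 -[X in _ == X]xP.
      rewrite -addrA; apply/eqP; congr (x _ + (x _ + x _)); exact/val_inj.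
Qed.

(** * Homomorphisms between root representations *)

Section HomsBetweenRoots.
Variables (d d' : dimvec D4) (f : rep_hom (root_rep d) (root_rep d')).

(** A leaf space is zero or a line spanned by the restriction of the all-ones vector; [c i] is read
    off from the image of that vector. *)
Lemma root_hom_leaf : exists c : 'I_3 -> L, forall i (x : root_sp d (Some i)),
  submod_val (f (Some i) x) i = c i * submod_val x i.
Proof.
pose one : E := [ffun=> 1].
exists (fun i => submod_val (f (Some i) (SubMod (leaf_restr_mem d i one))) i) => i x.
have -> : x = (submod_val x i : L) *: SubMod (leaf_restr_mem d i one).
  apply/val_inj/ffunP=> j; rewrite /= !ffunE.
  case: ifP => [/andP[/eqP-> _]|]; first by rewrite scaleoE mulr1.
  by move=> /negbT; rewrite negb_and negbK => /root_sp_leaf->; rewrite scaler0.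
set y := SubMod _; rewrite linearZ /= !ffunE.
have [d0|d0] := eqVneq (d (Some i)) 0%N; last first.
  by rewrite eqxx /= !scaleoE mulr1 mulrC.
have -> : y = 0 by apply/val_inj/ffunP=> j; rewrite /= !ffunE d0 andbF.
by rewrite linear0 /= ffunE scaler0 mul0r.
Qed.

(** Edge i extracts the i-th coordinate when leaf i is present in [d'], so compatibility with that
    edge determines it; if leaf i is absent from [d], it must vanish. *)
Lemma root_hom_center (c : 'I_3 -> L) :
    (forall i (x : root_sp d (Some i)),
      submod_val (f (Some i) x) i = c i * submod_val x i) ->
  forall i (y : root_sp d None), d' (Some i) != 0%N ->
  submod_val (f None y) i = if d (Some i) == 0%N then 0 else c i * submod_val y i.
Proof.
move=> fc i y d'i; have := fc i (root_map (i := i) y).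
have /(congr1 (fun z : root_sp d' (Some i) => submod_val z i)) := rep_homP f (e := i) y.
rewrite /= => ->; rewrite !ffunE eqxx d'i /= => ->.
by case: eqP => _ //=; rewrite mulr0.
Qed.

End HomsBetweenRoots.

(** A central line carries a single scalar, which the edges impose on every nonzero leaf. When the
    centre is the sum-zero plane, [f] acts on it diagonally by the [c i], and a diagonal map
    preserving this plane is scalar. *)
Lemma root_endo_scalar d (f : rep_hom (root_rep d) (root_rep d)) :
  d \in D4_posroots -> exists c : L, forall v x, f v x = c *: x.
Proof.
move=> /D4_posroots_cases dP; have [c fc] := root_hom_leaf f.
have fcc := root_hom_center fc.
have leaf i (x : root_sp d (Some i)) : f (Some i) x = c i *: x.
  apply/val_inj/ffunP=> j; rewrite /= ffunE.
  have [->|ji] := eqVneq j i; first exact: fc.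
  by rewrite !root_sp_leaf ?ji // scaler0.
have leaf0 i (a : L) (x : root_sp d (Some i)) :
    d (Some i) = 0%N -> f (Some i) x = a *: x.
  move=> di; apply/val_inj/ffunP=> j; rewrite /= ffunE !root_sp_leaf ?di ?orbT //.
  by rewrite scaler0.
case: dP => [[i di]|[d0 d1]|[d0 d1]].
- exists (c i) => -[j|] x.
    have [ji|ji] := eqVneq j i; first by rewrite -ji; exact: leaf.
    by apply: leaf0; rewrite di ffunE (inj_eq Some_inj) (negPf ji).
  have -> : x = 0 by apply: root_sp_center0; rewrite di ffunE.
  by rewrite linear0 scaler0.
- pose one : E := [ffun=> 1].
  have oneP : one \in root_space d None.
    by rewrite unfold_in /root_space d0; apply/forallP=> i; apply/forallP=> j;
       rewrite !ffunE.
  pose u : root_sp d None := SubMod oneP.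
  pose a : L := submod_val (f None u) 0.
  have fN x : f None x = a *: x.
    have -> : x = (submod_val x 0 : L) *: u.
      apply/val_inj/ffunP=> j; rewrite /= !ffunE scaleoE mulr1; exact: root_sp_center1.
    rewrite linearZ /= !scalerA mulrC -scalerA; congr (_ *: _).
    apply/val_inj/ffunP=> j; rewrite /= !ffunE scaleoE mulr1; exact: root_sp_center1.
  exists a => -[i|] x; last exact: fN.
  have [di|di] := eqVneq (d (Some i)) 0%N; first exact: leaf0.
  rewrite leaf; congr (_ *: _).
  have := fcc i u di; rewrite fN /= !ffunE (negPf di).
  by rewrite scaleoE !mulr1 => <-.
- have fN (y : root_sp d None) i : submod_val (f None y) i = c i * submod_val y i.
    by rewrite fcc d1.
  have eqc i j : c i = c j.
    have [->//|ij] := eqVneq i j.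
    (* The image of this vector has coordinate sum c_i - c_j, which must be zero. *)
    pose e : E := [ffun k => (k == i)%:R - (k == j)%:R].
    have sum_ij (g : 'I_3 -> L^o) :
        (forall k, k != i -> k != j -> g k = 0) -> \sum_k g k = g i + g j.
      move=> g0; rewrite (bigD1 i) //= (bigD1 j) ?(eq_sym j) //= big1 ?addr0 //.
      by move=> k /andP[]; exact: g0.
    have eP : e \in root_space d None.
      rewrite unfold_in /root_space d0 sum_ij => [|k ki kj]; rewrite !ffunE.
        by rewrite !eqxx (eq_sym j) (negPf ij) subr0 sub0r subrr.
      by rewrite (negPf ki) (negPf kj) subrr.
    have := root_sp_center2 (f None (SubMod eP)) d0; rewrite sum_ij => [|k ki kj].
      rewrite !fN /= !ffunE !eqxx (eq_sym j) (negPf ij) subr0 sub0r.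
      by rewrite mulr1 mulrN1 => /eqP; rewrite subr_eq0 => /eqP.
    by rewrite fN /= ffunE (negPf ki) (negPf kj) subrr mulr0.
  exists (c 0) => -[i|] x; first by rewrite leaf (eqc i 0).
  by apply/val_inj/ffunP=> i; rewrite fN /= ffunE (eqc i 0).
Qed.

(** The numerical hypotheses hold for roots of one orbit. If the centre is a line, some leaf lies in
    [d'] but not in [d]; its edge kills [f] at the centre, and the edges onto the other leaves carry
    this outwards. *)
Lemma root_hom_orbit_zero d d' (f : rep_hom (root_rep d) (root_rep d')) :
    d \in D4_posroots -> d' \in D4_posroots -> d != d' -> d None = d' None ->
    (\sum_i d (Some i) = \sum_i d' (Some i))%N ->
  forall v x, f v x = 0.
Proof.
move=> /D4_posroots_cases dP /D4_posroots_cases d'P dd' dd'0 dd'1.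
have [c fc] := root_hom_leaf f; have fcc := root_hom_center fc.
have leaf0 i (x : root_sp d (Some i)) :
    (d (Some i) == 0%N) || (d' (Some i) == 0%N) -> f (Some i) x = 0.
  case/orP => di; last first.
    by apply/val_inj/ffunP=> j; rewrite root_sp_leaf ?di ?orbT // ffunE.
  rewrite (_ : x = 0) ?linear0 //; apply/val_inj/ffunP=> j.
  by rewrite root_sp_leaf ?di ?orbT // ffunE.
case: dP => [[i di]|[d0 d1]|[d0 d1]].
- case: d'P => [[i' di']|[d'0 _]|[d'0 _]];
    try by exfalso; move: dd'0; rewrite d'0 di ffunE.
  move=> [j|] x; last first.
    have -> : x = 0 by apply: root_sp_center0; rewrite di ffunE.
    exact: linear0.
  apply: leaf0; rewrite di di' !ffunE.
  have [ji|] := eqVneq (Some j) (Some i) => //=.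
  by rewrite ji eqb0; apply: contra dd' => /eqP [ii']; rewrite di di' ii'.
- case: d'P => [[i' di']|[d'0 d'1]|[d'0 _]];
    try by exfalso; move: dd'0; rewrite ?d'0 d0 ?di' ?ffunE.
  have [i] : exists i, (d (Some i) < d' (Some i))%N.
    apply/existsP; apply: contraNT dd' => /existsPn le.
    have lei i : (d' (Some i) <= d (Some i))%N by rewrite leqNgt.
    have/eqP := dd'1; rewrite eq_sym (leqif_sum (fun i _ => leqif_eq (lei i))).2.
    move=> /forallP eqi; apply/eqP/ffunP=> -[i|]; last by rewrite d0 d'0.
    by apply/esym/eqP; exact: eqi.
  move=> lti.
  have di : d (Some i) = 0%N by have := d'1 i; lia.
  have d'i : d' (Some i) != 0%N by lia.
  have fN x : f None x = 0.
    apply/val_inj/ffunP=> j; rewrite /= ffunE.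
    rewrite (root_sp_center1 _ _ i d'0) fcc // di eqxx //.
  move=> [j|] x; last exact: fN.
  have [//|dj] := boolP ((d (Some j) == 0%N) || (d' (Some j) == 0%N)).
    exact: leaf0.
  move: dj; rewrite negb_or => /andP[dj d'j].
  pose one : E := [ffun=> 1].
  have oneP : one \in root_space d None.
    by rewrite unfold_in /root_space d0; apply/forallP=> k; apply/forallP=> l;
       rewrite !ffunE.
  (* Leaf j lies in both roots, so evaluating at the constant vector gives c_j = 0. *)
  have := fcc j (SubMod oneP) d'j; rewrite fN (negPf dj) /= !ffunE mulr1 => cj.
  apply/val_inj/ffunP=> k; rewrite /= ffunE.
  have [->|kj] := eqVneq k j; first by rewrite fc -cj mul0r.
  by rewrite root_sp_leaf ?kj.
- case: d'P => [[i' di']|[d'0 d'1]|[d'0 d'1]];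
    try by exfalso; move: dd'0; rewrite ?d'0 d0 ?di' ?ffunE.
  by case/eqP: dd'; apply/ffunP=> -[i|]; rewrite ?d0 ?d'0 ?d1 ?d'1.
Qed.

End RootReps.

(** * Splitting off an indecomposable over L *)

Lemma ord3_third (i j k l : 'I_3) :
  i != j -> k != i -> k != j -> l != k -> (l == i) || (l == j).
Proof.
by elim/ord3_ind: i; elim/ord3_ind: j; elim/ord3_ind: k; elim/ord3_ind: l.
Qed.

Section RootSummand.
Variables (L : fieldType) (M : rep L D4).

Local Notation E := {ffun 'I_3 -> L^o}.
Local Notation V0 := (rep_sp M None).
Local Notation V i := (rep_sp M (Some i)).
Local Notation f i := (rep_map M (i : edge D4)).

Section HomsFromAndTo.
Variables (d : dimvec D4).
Variables (g : {linear V0 -> E}) (h : forall i : 'I_3, {scalar V i}).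
Variables (A : {linear E -> V0}) (z : forall i : 'I_3, V i).
Hypothesis gd : forall y, g y \in @root_space L d None.
Hypothesis hg : forall (i : 'I_3) y, d (Some i) != 0%N -> h i (f i y) = g y i.
Hypothesis Az : forall (c : E) (i : 'I_3), c \in @root_space L d None ->
  f i (A c) = if d (Some i) == 0%N then 0 else (c i : L) *: z i.
Hypothesis gA : {in (@root_space L d None), forall c, g (A c) = c}.
Hypothesis hz : forall i : 'I_3, d (Some i) != 0%N -> h i (z i) = 1.

Definition to_root v : rep_sp M v -> root_sp L d v :=
  match v with
  | None => fun y => SubMod (gd y)
  | Some i => fun y => SubMod (leaf_restr_mem d i [ffun=> h i y])
  end.

Lemma to_root_linear v : linear (@to_root v).
Proof.
case: v => [i|] a x y; apply/val_inj; rewrite /= ?linearP //.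
apply/ffunP=> j; rewrite !ffunE; case: ifP => _; last by rewrite scaler0 addr0.
by rewrite ?linearP.
Qed.

Lemma to_root_map (e : edge D4) (x : rep_sp M (src e)) :
  mk_linear (@to_root_linear (tgt e)) (rep_map M e x)
  = rep_map (root_rep L d) e (mk_linear (@to_root_linear (src e)) x).
Proof.
apply/val_inj/ffunP=> j; rewrite /= !ffunE.
by case: ifP => // /andP[/eqP-> de]; rewrite hg.
Qed.

Definition from_root v : root_sp L d v -> rep_sp M v :=
  match v with
  | None => fun c => A (submod_val c)
  | Some i => fun c => (submod_val c i : L) *: z i
  end.

Lemma from_root_linear v : linear (@from_root v).
Proof.
case: v => [i|] a x y; last exact: linearP.
by rewrite /= !ffunE scalerDl scalerA.
Qed.

Lemma from_root_map (e : edge D4) (x : rep_sp (root_rep L d) (src e)) :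
  mk_linear (@from_root_linear (tgt e)) (rep_map (root_rep L d) e x)
  = rep_map M e (mk_linear (@from_root_linear (src e)) x).
Proof.
rewrite /= Az; last exact: submod_valP.
by rewrite !ffunE eqxx /=; case: eqP => _ /=; rewrite ?scale0r.
Qed.

(** [A] and [z] assemble to the inclusion, [g] and [h] to the retraction: [Az] and [hg] are
    compatibility with the edges, [gA] and [hz] say that the composite is the identity at centre and
    leaves. *)
Lemma root_summand : exists (i : rep_hom (root_rep L d) M)
  (p : rep_hom M (root_rep L d)), forall v, cancel (i v) (p v).
Proof.
exists (@RepHom _ _ (root_rep L d) M (fun v => mk_linear (@from_root_linear v))
  from_root_map).
exists (@RepHom _ _ M (root_rep L d) (fun v => mk_linear (@to_root_linear v))
  to_root_map).
case=> [i|] x; apply/val_inj; rewrite /=; last by rewrite gA ?submod_valP.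
apply/ffunP=> j; rewrite !ffunE.
case: ifP => [/andP[/eqP-> di]|/negbT].
  by rewrite linearZ /= hz // mulr1.
by rewrite negb_and negbK => /root_sp_leaf->.
Qed.
End HomsFromAndTo.

Definition root_is_summand := exists2 d, d \in D4_posroots &
  exists (i : rep_hom (root_rep L d) M) (p : rep_hom M (root_rep L d)),
  forall v, cancel (i v) (p v).

(** The line of [x] is split off by a functional that kills the image of the edge map; the root is
    simple at leaf i. *)
Lemma simple_leaf_summand (i : 'I_3) (x : V i) :
  ~ (exists y, f i y = x) -> root_is_summand.
Proof.
move=> nx; have [|l [lx lf]] :=
  @separating_functional _ _ (fun y => exists z, f i z = y) x _ nx.
  split=> [|a _ _ [y <-] [z <-]]; first by exists 0; rewrite linear0.
  by exists (a *: y + z); rewrite linearP.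
exists [ffun v => (v == Some i) : nat]; first exact: simple_root_mem.
set d := [ffun _ => _]; have d0 : d None = 0%N by rewrite ffunE.
have dS (j : 'I_3) : d (Some j) != 0%N -> j = i.
  by rewrite ffunE (inj_eq Some_inj) eqb0 negbK => /eqP.
have c0 c : c \in @root_space L d None -> c = 0.
  by rewrite unfold_in /root_space d0 => /eqP.
pose h0 (j : 'I_3) : {scalar V j} := \0.
pose h : forall j : 'I_3, {scalar V j} :=
  @dfwith _ (fun j : 'I_3 => {scalar V j}) h0 i l.
pose z : forall j : 'I_3, V j :=
  @dfwith _ (fun j : 'I_3 => V j : Type) (fun j => 0) i x.
apply: (@root_summand d \0 h \0 z) => [y|j y /dS ->|c j /c0 ->|c /c0->|j /dS ->].
- exact: rpred0.
- by rewrite /h dfwith_in lf ?ffunE //; exists y.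
- rewrite /= linear0; case: ifP => // _.
  by have -> : (0 : E) j = 0; rewrite ?ffunE ?scale0r.
- by [].
- by rewrite /h /z !dfwith_in.
Qed.

Hypothesis f_surj : forall (i : 'I_3) (x : V i), exists y, f i y = x.

Definition ker_sum (S : {set 'I_3}) (x : V0) :=
  exists k : 'I_3 -> V0, (forall i, i \in S -> f i (k i) = 0) /\
    x = \sum_(i in S) k i.

Lemma ker_sum_subspace S : subspace (ker_sum S).
Proof.
split=> [|a _ _ [k [kS ->]] [l [lS ->]]].
  by exists (fun=> 0); split=> [i _|]; rewrite ?linear0 // big1.
exists (fun i => a *: k i + l i); split=> [i iS|].
  by rewrite linearP kS // lS // scaler0 addr0.
by rewrite big_split scaler_sumr.
Qed.

Lemma ker_sum_ker (S : {set 'I_3}) (i : 'I_3) x : i \in S -> f i x = 0 -> ker_sum S x.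
Proof.
move=> iS fx; exists (fun j => if j == i then x else 0); split=> [j _|].
  by case: eqP => [->|]; rewrite ?linear0.
by rewrite (bigD1 i) //= eqxx big1 ?addr0 // => j /andP[_ /negPf->].
Qed.

(** A functional [l] with l(x) = 1 killing the kernels K_i for i in S descends to those leaves,
    while [x] maps to zero in the others. So [x] generates a summand whose leaves are exactly S. *)
Lemma dim1_center_summand (S : {set 'I_3}) (x : V0) :
    (forall i, i \notin S -> f i x = 0) -> ~ ker_sum S x -> root_is_summand.
Proof.
move=> xS /(separating_functional (ker_sum_subspace S))[l [lx lS]].
pose d : dimvec D4 :=
  [ffun v : option 'I_3 => if v is Some i then (i \in S) : nat else 1%N].
have dS i : (d (Some i) == 0%N) = (i \notin S) by rewrite ffunE eqb0.
have d0 : d None = 1%N by rewrite ffunE.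
exists d; first by apply: center1_root_mem => // i; rewrite ffunE; case: (_ \in _).
have c_const c i : c \in @root_space L d None -> c i = c 0.
  by move=> cd; exact: (root_sp_center1 (SubMod cd) i 0 d0).
have hE (i : 'I_3) : exists h : {scalar V i}, i \in S -> forall y, h (f i y) = l y.
  have [iS|niS] := boolP (i \in S); last by exists \0.
  have [|h hl] := @factor_functional _ _ _ (f i) l (@f_surj i); last by exists h.
  by move=> y /(ker_sum_ker iS)/lS.
pose h i := sval (boolp.cid (hE i)); have hP i := svalP (boolp.cid (hE i)).
have gL : linear (fun y => [ffun=> l y] : E).
  by move=> a y z; apply/ffunP=> i; rewrite !ffunE linearP.
have AL : linear (fun c : E => (c 0 : L) *: x).
  by move=> a y z; rewrite !ffunE scalerDl scalerA.
apply: (@root_summand d (mk_linear gL) h (mk_linear AL) (fun i => f i x))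
  => [y|i y|c i cd|c cd|i]; rewrite ?dS ?negbK.
- rewrite unfold_in /root_space d0.
  by apply/forallP=> i; apply/forallP=> j; rewrite !ffunE.
- by move=> iS; rewrite /= ffunE hP.
- rewrite /= linearZ /= (c_const c i) //.
  by case: ifP => // /xS ->; rewrite scaler0.
- by apply/ffunP=> i; rewrite /= ffunE linearZ /= lx (c_const c i) // mulr1.
- by move=> iS; rewrite hP.
Qed.

Hypothesis ker_sums : forall (S : {set 'I_3}) (x : V0),
  (forall i, i \notin S -> f i x = 0) -> ker_sum S x.

(** Taking S to be the third index alone puts [x] in all three kernels; the empty S then makes it
    zero. *)
Lemma ker_meet (i j : 'I_3) x : i != j -> f i x = 0 -> f j x = 0 -> x = 0.
Proof.
move=> ij fi fj; have all0 (k : 'I_3) : f k x = 0.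
  have [->//|ki] := eqVneq k i; have [->//|kj] := eqVneq k j.
  have [|l [lS ->]] := ker_sums (S := [set k]) (x := x); last first.
    by rewrite big_set1 lS ?set11.
  move=> l; rewrite inE => lk.
  by have /orP[/eqP->|/eqP->] := ord3_third ij ki kj lk.
have [|k [_ ->]] := @ker_sums set0 x.
  by move=> l _; apply: all0.
by rewrite big_set0.
Qed.

Lemma ker_split (i j k : 'I_3) x : i != j -> j != k -> i != k -> f i x = 0 ->
  exists y z, [/\ f j y = 0, f k z = 0 & x = y + z].
Proof.
move=> ij jk ik fi; have [|l [lS ->]] := ker_sums (S := [set j; k]) (x := x).
  move=> l; rewrite !inE negb_or => /andP[lj lk].
  have := ord3_third jk ij ik (_ : l != i); rewrite (negPf lj) (negPf lk).
  by case: (eqVneq l i) => [->//|_ /(_ isT)].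
exists (l j), (l k); split; [apply: lS|apply: lS|]; rewrite ?inE ?eqxx ?orbT //.
by rewrite big_setU1 ?inE ?big_set1.
Qed.

Lemma ker_total x : exists k : 'I_3 -> V0,
  (forall i, f i (k i) = 0) /\ x = k 0 + k 1 + k 2%:R.
Proof.
have [|k [kS ->]] := ker_sums (S := setT) (x := x); first by move=> i; rewrite inE.
exists k; split=> [i|]; first by apply: kS; rewrite inE.
by rewrite -sum_ord3; apply: eq_bigl => i; rewrite inE.
Qed.

(** Some kernel contains a nonzero vector, and [ker_split] writes it as a sum from the other two
    kernels; moving these to the other side gives the relation. *)
Lemma ker_triple : ~ rep_zero M -> exists k : 'I_3 -> V0,
  [/\ forall i, f i (k i) = 0, k 0 + k 1 + k 2%:R = 0 & k 1 <> 0].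
Proof.
move=> M0; have [y y0] : exists y : V0, y <> 0.
  apply: boolp.contrapT => /boolp.forallNP V00; apply: M0 => -[i|] x.
    by have [y <-] := f_surj x; rewrite (boolp.contrapT (V00 y)) linear0.
  exact: boolp.contrapT (V00 x).
have [k [kK yk]] := ker_total y.
have [j kj] : exists j, k j <> 0.
  apply: boolp.contrapT => /boolp.forallNP k0; apply: y0.
  by rewrite yk !(boolp.contrapT (k0 _)) !addr0.
(* If x_1 were zero, x_0 = - x_2 would lie in two kernels, so the whole triple would vanish. *)
have x1_neq0 (x : 'I_3 -> V0) : (forall i, f i (x i) = 0) -> x 0 + x 1 + x 2%:R = 0 ->
    (exists j, x j <> 0) -> x 1 <> 0.
  move=> xK xs [l xl] x1; apply: xl; move: xs; rewrite x1 addr0 => /eqP.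
  rewrite addr_eq0 => /eqP x02.
  have x0 : x 0 = 0.
    apply: (@ker_meet 0 2%:R) => //; rewrite x02 linearN xK oppr0 //.
  have x2 : x 2%:R = 0 by apply/eqP; rewrite -oppr_eq0 -x02 x0.
  by elim/ord3_ind: l.
pose mk (a b c : V0) (i : 'I_3) := nth 0 [:: a; b; c] i.
have mkP a b c : f 0 a = 0 -> f 1 b = 0 -> f 2%:R c = 0 ->
    forall i, f i (mk a b c i) = 0.
  by move=> ? ? ?; apply: ord3_ind.
elim/ord3_ind: j kj => kj.
- have [//|//|//|a [b [aK bK kab]]] := @ker_split 0 1 2%:R (k 0) _ _ _ (kK _).
  have s0 :
      mk (k 0) (- a) (- b) 0 + mk (k 0) (- a) (- b) 1 + mk (k 0) (- a) (- b) 2%:R = 0.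
    by rewrite /mk /= kab -addrA -opprD subrr.
  have sK := mkP (k 0) (- a) (- b) (kK 0).
  exists (mk (k 0) (- a) (- b)); rewrite linearN aK oppr0 linearN bK oppr0 in sK.
  split; [exact: sK|exact: s0|apply: x1_neq0 s0 _; [exact: sK|by exists 0]].
- have [//|//|//|a [b [aK bK kab]]] := @ker_split 1 0 2%:R (k 1) _ _ _ (kK _).
  exists (mk (- a) (k 1) (- b)); split=> //;
    last by rewrite /mk /= kab addrA addNr add0r subrr.
  by apply: mkP; rewrite ?linearN ?aK ?bK ?oppr0.
- have [//|//|//|a [b [aK bK kab]]] := @ker_split 2%:R 0 1 (k 2%:R) _ _ _ (kK _).
  have s0 :
      mk (- a) (- b) (k 2%:R) 0 + mk (- a) (- b) (k 2%:R) 1 +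
      mk (- a) (- b) (k 2%:R) 2%:R = 0.
    by rewrite /mk /= kab -opprD addNr.
  have sK : forall i, f i (mk (- a) (- b) (k 2%:R) i) = 0.
    by apply: mkP; rewrite ?linearN ?aK ?bK ?oppr0.
  exists (mk (- a) (- b) (k 2%:R)); split=> //; apply: x1_neq0 s0 _ => //.
  by exists 2%:R.
Qed.

(* Now the centre is the direct sum of any two of the kernels K_i.  With x_i  *)
(* in K_i nonzero and x_0 + x_1 + x_2 = 0, a sum-zero c is sent to            *)
(* c_0 x_2 - c_2 x_0; the retraction is given by functionals m_i killing K_i  *)
(* with m_0 + m_1 + m_2 = 0 and m_i (x_(i+2)) = 1, indices modulo 3.          *)
Lemma dim2_center_summand : ~ rep_zero M -> root_is_summand.
Proof.
move=> /ker_triple[x [xK xs x1]].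
have [|n [nx1 nK0]] := separating_functional (kernel_subspace (f 0)) (x := x 1).
  by move=> f0; apply: x1; apply: (@ker_meet 0 1).
(* The third edge map restricts to an isomorphism from K_1 to its leaf, because K_1 and K_2 are
   complementary; [h2] is [n] transported along it. Then n - h2 f_2 kills K_1. *)
have [v|c|a v w b c|h2 h2P] := @scalar_of_graph _ (V 2%:R)
    (fun v c => exists k, [/\ f 1 k = 0, f 2%:R k = v & n k = c]).
- have [y <-] := f_surj v; have [k [kK ->]] := ker_total y.
  have [//|//|//|a [b [aK bK ->]]] := @ker_split 0 1 2%:R (k 0) _ _ _ (kK _).
  exists (n (a + k 1)), (a + k 1); split=> //; first by rewrite linearD aK kK addr0.
  by rewrite !linearD bK !kK !addr0.
- by case=> k [k1 k2 <-]; rewrite (@ker_meet 1 2%:R k) // linear0.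
- case=> k [k1 <- <-] [l [l1 <- <-]]; exists (a *: k + l).
  by rewrite !linearP k1 l1 scaler0 addr0.
have h2E k : f 1 k = 0 -> h2 (f 2%:R k) = n k.
  move=> k1; have [l [l1 l2 <-]] := h2P (f 2%:R k).
  suff /eqP : l - k = 0 by rewrite subr_eq0 => /eqP->.
  by apply: (@ker_meet 1 2%:R) => //; rewrite linearB ?l1 ?k1 ?l2 subrr.
pose m (i : 'I_3) (y : V0) : L :=
  nth 0 [:: - n y; n y - h2 (f 2%:R y); h2 (f 2%:R y)] i.
have mL i : scalar (m i).
  move=> a y z; elim/ord3_ind: i; rewrite /m /= !linearP; ring.
have mK : forall i (y : V0), f i y = 0 -> m i y = 0.
  apply: ord3_ind => y fy; rewrite /m /=; first by rewrite nK0 ?oppr0.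
    by rewrite h2E // subrr.
  by rewrite fy linear0.
have hE (i : 'I_3) : exists h : {scalar V i}, forall y, h (f i y) = m i y.
  exact: (@factor_functional _ _ _ (f i) (mk_scalar (mL i))) (@f_surj i) (mK i).
pose h i := sval (boolp.cid (hE i)).
have hP i : forall y, h i (f i y) = m i y := svalP (boolp.cid (hE i)).
pose d : dimvec D4 := [ffun v : option 'I_3 => if v is Some i then 1%N else 2%N].
have d0 : d None = 2%N by rewrite ffunE.
have d1 i : d (Some i) = 1%N by rewrite ffunE.
exists d; first exact: center2_root_mem.
have gL : linear (fun y => [ffun i => m i y] : E).
  by move=> a y z; apply/ffunP=> i; rewrite !ffunE mL.
have AL : linear (fun c : E => (c 0 : L) *: x 2%:R - (c 2%:R : L) *: x 0).
  move=> a y z; rewrite !ffunE !scalerDl -!scalerA scalerBr opprD addrACA.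
  by [].
pose X (i : 'I_3) := nth 0 [:: x 2%:R; x 0; x 1] i.
have m2x1 : h2 (f 2%:R (x 1)) = 1 by rewrite h2E.
have e0 : x 0 = - (x 1 + x 2%:R).
  by apply/eqP; rewrite -addr_eq0 addrA xs.
have e2 : x 2%:R = - (x 0 + x 1).
  by apply/eqP; rewrite -addr_eq0 addrC xs.
have m2x0 : h2 (f 2%:R (x 0)) = -1.
  by rewrite e0 linearN linearD xK addr0 linearN m2x1.
have nx2 : n (x 2%:R) = -1.
  by rewrite e2 linearN linearD nK0 // add0r nx1.
have sum0 c : c \in @root_space L d None -> c 0 + c 1 + c 2%:R = 0.
  by rewrite unfold_in /root_space d0 sum_ord3 => /eqP.
apply: (@root_summand d (mk_linear gL) h (mk_linear AL) (fun i => f i (X i)))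
  => [y|i y _|c i cd|c cd|i _].
- rewrite unfold_in /root_space d0 sum_ord3 !ffunE /m /=; apply/eqP; ring.
- by rewrite hP /= ffunE.
- rewrite d1 /= linearB ![f i (_ *: _)]linearZ /=.
  move: cd => /sum0; elim/ord3_ind: i => cd /=.
  + by rewrite xK scaler0 subr0.
  + rewrite {1}e2 linearN linearD xK addr0 scalerN -opprD -scalerDl -scaleNr.
    by congr (_ *: _); apply/eqP; rewrite eq_sym -addr_eq0 addrA [c 1 + _]addrC cd.
  + rewrite xK scaler0 sub0r -scalerN; congr (_ *: _).
    by rewrite e0 linearN linearD xK addr0 opprK.
- have c1 : c 1 = - (c 0 + c 2%:R).
    by apply/eqP; rewrite -addr_eq0 addrA [c 1 + _]addrC sum0.
  have nA : n (mk_linear AL c) = - c 0.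
    by rewrite /= linearB /= !linearZ /= nx2 nK0 // mulr0 subr0 mulrN1.
  have m2A : h2 (f 2%:R (mk_linear AL c)) = c 2%:R.
    rewrite /= linearB /= linearB /= ![f _ (_ *: _)]linearZ /= xK scaler0 linear0.
    by rewrite sub0r linearZ /= m2x0 mulrN1 opprK.
  apply/ffunP=> i; rewrite [LHS]ffunE; elim/ord3_ind: i; rewrite /m /= ?nA ?m2A.
  + by rewrite opprK.
  + by rewrite c1 opprD.
  + by [].
- rewrite hP; elim/ord3_ind: i; rewrite /m /X /=.
  + by rewrite nx2 opprK.
  + by rewrite nK0 // m2x0 sub0r opprK.
  + by [].
Qed.

End RootSummand.

Lemma root_summand_exists (L : fieldType) (M : rep L D4) :
  ~ rep_zero M -> root_is_summand M.
Proof.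
move=> M0; have [[i [x nx]]|surj] := boolp.pselect (exists i (x : rep_sp M (Some i)),
    ~ (exists y, rep_map M (i : edge D4) y = x)).
  exact: simple_leaf_summand nx.
have f_surj (i : 'I_3) (x : rep_sp M (Some i)) :
    exists y, rep_map M (i : edge D4) y = x.
  by apply: boolp.contrapT => nx; apply: surj; exists i, x.
have [[S [x [xS nx]]]|sums] := boolp.pselect (
    exists (S : {set 'I_3}) (x : rep_sp M None),
    (forall i : 'I_3, i \notin S -> rep_map M (i : edge D4) x = 0) /\
    ~ ker_sum (M := M) S x).
  exact: dim1_center_summand xS nx.
apply: dim2_center_summand => // S x xS.
by apply: boolp.contrapT => nx; apply: sums; exists S, x.
Qed.

(** * Sums over sets of roots *)

Lemma root_rep_nonzero (L : fieldType) d :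
  d \in D4_posroots -> exists v (x : root_sp L d v), x <> 0.
Proof.
move=> dR; have [v dv] : exists v, d v != 0%N.
  case: (D4_posroots_cases dR) => [[i ->]|[d0 _]|[d0 _]].
  - by exists (Some i); rewrite ffunE eqxx.
  - by exists None; rewrite d0.
  - by exists None; rewrite d0.
have [f /bij_inj fI] := root_rep_dimvec L dR v.
exists v, (f (const_mx 1)); rewrite -[X in _ <> X](linear0 f) => /fI/rowP.
case: (d v) dv => // n _ in f fI *; move=> /(_ ord0)/eqP.
by rewrite !mxE oner_eq0.
Qed.

Lemma root_rep_not_zero (L : fieldType) d :
  d \in D4_posroots -> ~ rep_zero (root_rep L d).
Proof. by move=> /(root_rep_nonzero L)[v [x x0]] /(_ v x). Qed.

Lemma root_rep_brick (L : fieldType) d :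
  d \in D4_posroots -> rep_brick (root_rep L d).
Proof.
move=> dR f [v [x fx]] w; have [c fc] := root_endo_scalar f dR.
have c0 : c != 0 by apply/eqP=> c0; apply: fx; rewrite fc c0 scale0r.
by exists (fun y => c^-1 *: y) => y; rewrite fc scalerA ?mulVf ?mulfV // scale1r.
Qed.

Lemma root_rep_indec (L : fieldType) d :
  d \in D4_posroots -> rep_indec (root_rep L d).
Proof.
by move=> dR; apply: brick_indec; [apply: root_rep_not_zero|apply: root_rep_brick].
Qed.

(** For uniqueness, an indecomposable [N] equals its own root summand, and the dimension vector
    identifies the root. *)
Lemma root_rep_the_indec (L : fieldType) d :
  d \in D4_posroots -> the_indec_of_dimvec d (root_rep L d).
Proof.
move=> dR; split=> [||N Ni Nd]; [exact: root_rep_indec|exact: root_rep_dimvec|].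
have [d' d'R [i [p pK]]] := root_summand_exists Ni.1.
have NX := indec_retract pK Ni (root_rep_not_zero (d := d') d'R).
by rewrite (has_dimvec_iso NX Nd (root_rep_dimvec L d'R)).
Qed.

Section OrbitRep.
Variables (L : fieldType) (O : {set posroot}).

Local Notation E := {ffun 'I_3 -> L^o}.
Local Notation F := {ffun posroot -> E}.

(** The direct sum is realised by functions on all roots supported on [O], so that the Galois group
    acts by one formula permuting roots and coordinates; [sum_rep_iso] compares it with the iterated
    [rep_sum]. *)
Definition sum_space (v : vert D4) : {pred F} := fun x =>
  [forall r, if r \in O then x r \in @root_space L (val r) v else x r == 0].

Lemma sum_spaceP v (x : F) :
  reflect (forall r, (r \in O -> x r \in @root_space L (val r) v) /\
    (r \notin O -> x r = 0)) (x \in sum_space v).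
Proof.
apply: (iffP forallP) => xP r; have := xP r; case: (r \in O) => //=.
- by move=> /eqP x0; split.
- by case=> ->.
- by case=> _ ->.
Qed.

Lemma sum_space_closed v : submod_closed (sum_space v).
Proof.
split=> [|a x y /sum_spaceP xP /sum_spaceP yP].
  by apply/sum_spaceP => r; rewrite ffunE; split=> // _; apply: rpred0.
apply/sum_spaceP=> r; rewrite !ffunE; split=> rO.
  by apply: rpredD; [apply: rpredZ; apply: (xP r).1|apply: (yP r).1].
by rewrite (xP r).2 // (yP r).2 // scaler0 addr0.
Qed.
HB.instance Definition _ v :=
  GRing.isSubmodClosed.Build L F (sum_space v) (sum_space_closed v).

Definition sum_sp v := submod (sum_space v : submodClosed F).

Lemma sum_sp_out v (x : sum_sp v) r : r \notin O -> submod_val x r = 0.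
Proof. by case: x => x /= /sum_spaceP/(_ r)[]. Qed.

Definition sum_restr i (x : F) : F := [ffun r => leaf_restr (val r) i (x r)].

Lemma sum_restr_mem (i : edge D4) (x : sum_sp (src i)) :
  sum_restr i (submod_val x) \in sum_space (tgt i).
Proof.
case: x => x /= /sum_spaceP xP; apply/sum_spaceP=> r; rewrite ffunE; split=> rO.
  exact: leaf_restr_mem.
by rewrite (xP r).2 //; apply/ffunP=> j; rewrite !ffunE; case: ifP.
Qed.

Definition sum_map (i : edge D4) (x : sum_sp (src i)) : sum_sp (tgt i) :=
  SubMod (sum_restr_mem x).

Lemma sum_map_linear i : linear (@sum_map i).
Proof.
move=> a x y; apply/val_inj/ffunP=> r; apply/ffunP=> j; rewrite !ffunE /=.
by case: ifP => _; rewrite ?ffunE // scaler0 addr0.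
Qed.

Definition sum_rep : rep L D4 :=
  @Rep L D4 (fun v => sum_sp v : lmodType L)
    (fun e => mk_linear (@sum_map_linear e)).

Section Component.
Variables (r : posroot) (rO : r \in O).

Definition single (c : E) : F := [ffun r' => if r' == r then c else 0].

Lemma single_mem v (c : root_sp L (val r) v) :
  single (submod_val c) \in sum_space v.
Proof.
apply/sum_spaceP=> r'; rewrite ffunE; case: eqP => [->|_]; rewrite ?rO; split=> // _.
- exact: submod_valP.
- exact: rpred0.
Qed.

Definition inc v (c : root_sp L (val r) v) : sum_sp v := SubMod (single_mem c).

Lemma inc_linear v : linear (@inc v).
Proof.
move=> a x y; apply/val_inj/ffunP=> r'; rewrite !ffunE /=.
by case: ifP => // _; rewrite scaler0 addr0.
Qed.

Lemma inc_map (e : edge D4) x :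
  mk_linear (@inc_linear (tgt e)) (rep_map (root_rep L (val r)) e x)
  = rep_map sum_rep e (mk_linear (@inc_linear (src e)) x).
Proof.
apply/val_inj/ffunP=> r'; rewrite /= !ffunE; case: eqP => [->//|_].
by apply/ffunP=> j; rewrite !ffunE; case: ifP.
Qed.

Definition sum_inc : rep_hom (root_rep L (val r)) sum_rep :=
  @RepHom _ _ (root_rep L (val r)) sum_rep (fun v => mk_linear (@inc_linear v))
    inc_map.

Lemma component_mem v (x : sum_sp v) :
  submod_val x r \in @root_space L (val r) v.
Proof. by case: x => x /= /sum_spaceP/(_ r)[/(_ rO)]. Qed.

Definition component v (x : sum_sp v) : root_sp L (val r) v :=
  SubMod (component_mem x).

Lemma component_linear v : linear (@component v).
Proof. by move=> a x y; apply/val_inj; rewrite /= !ffunE. Qed.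

Lemma component_map (e : edge D4) x :
  mk_linear (@component_linear (tgt e)) (rep_map sum_rep e x)
  = rep_map (root_rep L (val r)) e (mk_linear (@component_linear (src e)) x).
Proof. by apply/val_inj; rewrite /= ffunE. Qed.

Definition sum_proj : rep_hom sum_rep (root_rep L (val r)) :=
  @RepHom _ _ sum_rep (root_rep L (val r))
    (fun v => mk_linear (@component_linear v)) component_map.

Lemma sum_incK v : cancel (sum_inc v) (sum_proj v).
Proof. by move=> x; apply/val_inj; rewrite /= ffunE eqxx. Qed.

End Component.

Lemma sum_decomp (V : lmodType L) v (f : {linear sum_sp v -> V}) (x : sum_sp v) :
  (forall r (rO : r \in O), f (inc rO (component rO x)) = 0) -> f x = 0.
Proof.
move=> fx.
have tmem r : single r (submod_val x r) \in sum_space v.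
  have [rO|nrO] := boolP (r \in O); first by have := single_mem rO (component rO x).
  apply/sum_spaceP=> r'; rewrite ffunE; case: eqP => [->|_]; split=> //.
  - by rewrite (negPf nrO).
  - by move=> _; apply: sum_sp_out.
  - by move=> _; apply: rpred0.
have -> : x = \sum_r (SubMod (tmem r) : sum_sp v).
  apply/val_inj; rewrite linear_sum /=; apply/ffunP=> r; rewrite sum_ffunE.
  rewrite (bigD1 r) //= big1 ?addr0 => [|r' r'r]; first by rewrite ffunE eqxx.
  by rewrite ffunE eq_sym (negPf r'r).
rewrite linear_sum big1 // => r _.
have [rO|nrO] := boolP (r \in O).
  rewrite -[RHS](fx r rO); congr (f _); exact/val_inj.
rewrite -[RHS](linear0 f); congr (f _); apply/val_inj/ffunP=> r'; rewrite /= !ffunE.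
by case: eqP => // _; apply: sum_sp_out.
Qed.

(** The invariant for induction on [s]: [g] embeds the partial sum as the functions supported on
    [s], and g f is truncation to [s]. *)
Lemma sum_rep_bigsum (s : seq posroot) : uniq s ->
  exists (f : rep_hom sum_rep
                (\big[@rep_sum L D4/rep0 L D4]_(r <- s | r \in O) root_rep L (val r)))
         (g : rep_hom (\big[@rep_sum L D4/rep0 L D4]_(r <- s | r \in O)
                         root_rep L (val r)) sum_rep),
    [/\ forall v, cancel (g v) (f v),
        forall v (x : sum_sp v) r, r \in s ->
          submod_val (g v (f v x)) r = submod_val x r
      & forall v x r, r \notin s -> submod_val (g v x) r = 0].
Proof.
elim: s => [_|r s IHs /= /andP[rs /IHs{IHs}[f [g [gK gf g0]]]]].
  rewrite big_nil; exists (rep_hom0 _ _), (rep_hom0 _ _); split=> //= v x.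
    by rewrite [LHS]thinmx0 [RHS]thinmx0.
  by move=> r _; rewrite ffunE.
rewrite big_cons; case: ifP => rO; last first.
  exists f, g; split=> // v x r'; rewrite inE.
    case: eqP => [-> _|_] /=; last exact: gf.
    by rewrite g0 // sum_sp_out // rO.
  by rewrite negb_or => /andP[_]; exact: g0.
exists (rep_pair (sum_proj rO) f), (rep_copair (sum_inc rO) g); split=> v.
- move=> [c y]; rewrite /= /pairing /= /copairing /=.
  have gr : component rO (g v y) = 0.
    by apply/val_inj; rewrite /= g0.
  have fi : f v (inc rO c) = 0.
    rewrite -[LHS]gK; rewrite (_ : g v _ = 0) ?linear0 //.
    apply/val_inj/ffunP=> r'; rewrite [RHS]ffunE.
    have [r's|] := boolP (r' \in s); last exact: g0.
    by rewrite gf //= ffunE; case: eqP r's => // ->; rewrite (negPf rs).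
  rewrite (linearD (f v)) fi add0r gK; congr (_, _).
  by rewrite [LHS](linearD (sum_proj rO v)) [X in _ + X]gr addr0 (sum_incK rO).
- move=> x r' r's; rewrite /= /copairing /= !ffunE; move: r's; rewrite inE.
  case: eqP => [-> _|_ /= r's]; first by rewrite g0 // addr0.
  by rewrite gf // add0r.
- move=> [c y] r'; rewrite inE negb_or => /andP[/negPf r'r r's].
  by rewrite /= /copairing /= !ffunE r'r g0 // add0r.
Qed.

Lemma sum_rep_iso :
  rep_iso sum_rep (\big[@rep_sum L D4/rep0 L D4]_(r in O) root_rep L (val r)).
Proof.
have [f [g [gK gf _]]] := sum_rep_bigsum (index_enum_uniq posroot).
exists f, g => v; split=> // x; apply/val_inj/ffunP=> r.
by apply: gf; rewrite mem_index_enum.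
Qed.

End OrbitRep.

(** * The rational structure on the sum over an orbit *)

Section OrbitKRep.
Variables (K : fieldType) (L : splittingFieldType K).
Variable iota : {morphism 'Gal({:L} / 1)%g >-> 'S_3}.

Local Notation E := {ffun 'I_3 -> L^o}.
Local Notation F := {ffun posroot -> E}.
Local Notation vact := (D4_vact iota).
Local Notation eact := (D4_eact iota).
Local Notation ract := (posroot_act iota).

Lemma posroot_actE r s v : val (ract r s) v = val r (vact v s^-1%g).
Proof. by rewrite /= ffunE. Qed.

Lemma posroot_actVE r s v : val (ract r s^-1%g) v = val r (vact v s).
Proof. by rewrite posroot_actE invgK. Qed.

Lemma posroot_act_center r s : val (ract r s) None = val r None.
Proof. by rewrite posroot_actE. Qed.

Lemma posroot_act_leaves r s :
  (\sum_i val (ract r s) (Some i) = \sum_i val r (Some i))%N.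
Proof.
rewrite [RHS](reindex_inj (act_inj eact s^-1%g)).
by apply: eq_bigr => i _; rewrite posroot_actE.
Qed.

Definition coord_act (s : gal_of {:L}) (c : E) : E :=
  [ffun j => s (c (eact j s^-1%g))].

(** Constant, sum-zero and singly supported vectors stay so when coordinates are permuted and [s] is
    applied to the entries. *)
Lemma root_space_act r s v c :
  c \in @root_space L (val (ract r s^-1%g)) v ->
  coord_act s c \in @root_space L (val r) (vact v s).
Proof.
case: v => [i|]; rewrite !unfold_in /root_space.
  move=> /forallP cP; apply/forallP=> j; rewrite ffunE.
  have := cP (eact j s^-1%g); rewrite posroot_actVE.
  have -> : (eact j s^-1%g == i) = (j == eact i s).
    by apply/eqP/eqP=> [<-|->]; rewrite ?actK ?actKV.
  case/orP => [->//|/eqP->]; by rewrite rmorph0 eqxx orbT.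
rewrite posroot_actVE /=; case: (ssval r None) => [|[|n]].
- by move=> /eqP->; apply/eqP/ffunP=> j; rewrite !ffunE rmorph0.
- move=> /forallP cP; apply/forallP=> i; apply/forallP=> j; rewrite !ffunE.
  by rewrite (eqP (forallP (cP _) (eact j s^-1%g))).
- move=> /eqP c0; apply/eqP.
  transitivity (s (\sum_j c j : L)); last by rewrite [X in s X]c0 rmorph0.
  rewrite rmorph_sum (reindex_inj (act_inj eact s)).
  by apply: eq_bigr => j _; rewrite ffunE actK.
Qed.

Definition sum_act (s : gal_of {:L}) (x : F) : F :=
  [ffun r => coord_act s (x (ract r s^-1%g))].

Lemma sum_actE s x r j : sum_act s x r j = s (x (ract r s^-1%g) (eact j s^-1%g)).
Proof. by rewrite !ffunE. Qed.

Lemma sum_act_comp s t x : sum_act s (sum_act t x) = sum_act (t * s)%g x.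
Proof.
by apply/ffunP=> r; apply/ffunP=> j; rewrite !sum_actE galTM invMg !actM.
Qed.

Lemma sum_act1 x : sum_act 1%g x = x.
Proof.
by apply/ffunP=> r; apply/ffunP=> j; rewrite sum_actE galT1 invg1 !act1.
Qed.

Section StableSet.
Variable O : {set posroot}.
Hypothesis Oact : forall r s, r \in O -> ract r s \in O.

Lemma sum_act_mem s v (x : F) : x \in @sum_space L O v ->
  sum_act s x \in @sum_space L O (vact v s).
Proof.
move=> /sum_spaceP xP; apply/sum_spaceP=> r; rewrite ffunE; split=> rO.
  by apply: root_space_act; apply: (xP _).1; apply: Oact.
rewrite (xP _).2; last by apply: contra rO => /(@Oact _ s); rewrite actKV.
by apply/ffunP=> j; rewrite !ffunE rmorph0.
Qed.

Definition orbit_sl v s (x : rep_sp (sum_rep L O) v) :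
    rep_sp (sum_rep L O) (rq_vact (D4_K iota) v s) :=
  SubMod (sum_act_mem s (submod_valP x)).

Lemma orbit_sl_semilinear v (s : gal_of {:L}) (a : L)
    (x y : rep_sp (sum_rep L O) v) :
  orbit_sl s (a *: x + y) = s a *: orbit_sl s x + orbit_sl s y.
Proof.
apply/val_inj/ffunP=> r; apply/ffunP=> j.
by rewrite /= !ffunE /= rmorphD rmorphM.
Qed.

Lemma sp_cast_sum_rep v w (h : v = w) (x : rep_sp (sum_rep L O) v) :
  submod_val (sp_cast h x) = submod_val x.
Proof. by case: w / h. Qed.

Lemma orbit_sl_bij v s : bijective (@orbit_sl v s).
Proof.
have inv_mem (y : rep_sp (sum_rep L O) (rq_vact (D4_K iota) v s)) :
    sum_act s^-1%g (submod_val y) \in @sum_space L O v.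
  by have := sum_act_mem s^-1%g (submod_valP y); rewrite actK.
exists (fun y => SubMod (inv_mem y)) => x; apply/val_inj; rewrite /= sum_act_comp.
  by rewrite mulgV sum_act1.
by rewrite mulVg sum_act1.
Qed.

Lemma orbit_slM v s t (x : rep_sp (sum_rep L O) v) :
  sp_cast (esym (actM (rq_vact (D4_K iota)) v t s)) (orbit_sl s (orbit_sl t x))
  = orbit_sl (t * s)%g x.
Proof. by apply/val_inj; rewrite /= sp_cast_sum_rep /= sum_act_comp. Qed.

Lemma orbit_sl_map e s (x : rep_sp (sum_rep L O) (@src D4 e)) :
  rep_map (sum_rep L O) (rq_eact (D4_K iota) e s)
    (sp_cast (esym (rq_src (r := D4_K iota) e s)) (orbit_sl s x))
  = sp_cast (esym (rq_tgt (r := D4_K iota) e s))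
      (orbit_sl s (rep_map (sum_rep L O) e x)).
Proof.
apply/val_inj; rewrite /= /sp_cast /=; apply/ffunP=> r; apply/ffunP=> j.
rewrite sum_actE !ffunE invgK.
have -> : (eact j s^-1%g == e) = (j == eact e s).
  by apply/eqP/eqP=> [<-|->]; rewrite ?actK ?actKV.
by case: ifP; rewrite ?rmorph0.
Qed.

Definition orbit_krep : krep (D4_K iota) :=
  @KRep _ _ (D4_K iota) (sum_rep L O) orbit_sl orbit_sl_semilinear orbit_sl_bij
    orbit_slM orbit_sl_map.

End StableSet.

(** * The brick attached to one orbit *)

Section Orbit.
Variable r0 : posroot.
Let O := orbit ract 'Gal({:L} / 1)%g r0.

Lemma gal_orbitP r : reflect (exists s, ract r0 s = r) (r \in O).
Proof.
apply: (iffP orbitP) => [[s _ <-]|[s <-]]; exists s => //.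
by rewrite gal1_setT inE.
Qed.

Lemma gal_orbit_act r s : r \in O -> ract r s \in O.
Proof.
by move=> /gal_orbitP[t <-]; apply/gal_orbitP; exists (t * s)%g; rewrite actM.
Qed.

Local Notation X := (orbit_krep gal_orbit_act).

Lemma orbit_hom_zero r r' (f : rep_hom (root_rep L (val r)) (root_rep L (val r'))) :
  r \in O -> r' \in O -> r != r' -> forall v x, f v x = 0.
Proof.
move=> /gal_orbitP[s rE] /gal_orbitP[s' r'E] rr'.
apply: root_hom_orbit_zero (ssvalP r) (ssvalP r') rr' _ _.
  by rewrite -rE -r'E !posroot_act_center.
by rewrite -rE -r'E !posroot_act_leaves.
Qed.

(** Off-diagonal blocks vanish by [orbit_hom_zero], diagonal ones are scalars by
    [root_endo_scalar]. *)
Lemma orbit_endo_diag (f : rep_hom (sum_rep L O) (sum_rep L O)) :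
  exists c : posroot -> L, forall r, r \in O -> forall v (x : sum_sp L O v),
    submod_val (f v x) r = c r *: submod_val x r.
Proof.
have cE r : exists c, r \in O -> forall v (x : sum_sp L O v),
    submod_val (f v x) r = c *: submod_val x r.
  have [rO|//] := boolP (r \in O); last by exists 0.
  have [c cP] := root_endo_scalar (rep_comp (sum_proj L rO) (rep_comp f (sum_inc L rO)))
    (ssvalP r).
  exists c => _ v x.
  have xr : submod_val (x - inc rO (component rO x)) r = 0.
    by rewrite /= !ffunE eqxx subrr.
  have fx : sum_proj L rO v (f v (x - inc rO (component rO x))) = 0.
    apply: (sum_decomp (f := sum_proj L rO v \o f v : {linear _ -> _})) => r' r'O /=.
    have [E|r'r] := eqVneq r' r; last first.
      exact: (orbit_hom_zero (rep_comp (sum_proj L rO) (rep_comp f (sum_inc L r'O)))).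
    rewrite (_ : inc _ _ = 0) ?linear0 //; first exact: (linear0 (sum_proj L rO v)).
    apply/val_inj/ffunP=> q; rewrite /= ffunE [RHS]ffunE.
    by case: eqP => // _; rewrite E.
  have /(congr1 val) := cP v (component rO x).
  rewrite /= => <-; apply/eqP; rewrite -subr_eq0.
  have /(congr1 val) := fx; rewrite /= => {1}<-.
  by rewrite linearB /= !ffunE.
exists (fun r => sval (boolp.cid (cE r))) => r.
exact: svalP (boolp.cid (cE r)).
Qed.

(** Equivariance makes the diagonal entries conjugate, c(s r) = s(c(r)). By transitivity on the
    orbit, one nonzero entry makes all of them nonzero, and the inverse is the diagonal of their
    inverses. *)
Lemma orbit_krep_brick : krep_brick X.
Proof.
move=> f [w [x fx]]; have [c cP] := orbit_endo_diag f.
have c_act r s : r \in O -> c (ract r s) = s (c r).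
  move=> rO; have rsO := gal_orbit_act s rO.
  have [v [y y0]] := root_rep_nonzero L (ssvalP r).
  have [j yj] : exists j, submod_val y j != 0.
    apply: boolp.contrapT => /boolp.forallNP yj; apply: y0.
    by apply/val_inj/ffunP=> j; rewrite [RHS]ffunE; apply/eqP/negPn/negP/yj.
  pose z : sum_sp L O v := inc rO y.
  have /(congr1 (fun u : sum_sp L O (vact v s) =>
    submod_val u (ract r s) (eact j s))) := krep_homP f s (z : rep_sp X v).
  rewrite /= cP // ffunE /= !sum_actE !actK cP // !ffunE eqxx /=.
  have syj : s (submod_val y j : L) != 0 by rewrite fmorph_eq0.
  by rewrite !scaleoE rmorphM; apply: (mulIf syj).
have [r1 r1O cr1] : exists2 r, r \in O & c r != 0.
  apply: boolp.contrapT => nc; apply: fx; apply/val_inj/ffunP=> r; rewrite [RHS]ffunE.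
  have [rO|nrO] := boolP (r \in O); last exact: sum_sp_out.
  rewrite cP //; have [->|cr] := eqVneq (c r) 0; first by rewrite scale0r.
  by case: nc; exists r.
have c0 r : r \in O -> c r != 0.
  move: r1O cr1 => /gal_orbitP[s <-] + /gal_orbitP[t <-].
  rewrite !c_act ?fmorph_eq0 //; apply/gal_orbitP; by exists 1%g; rewrite act1.
move=> v.
have inv_mem (y : sum_sp L O v) :
    [ffun r => (c r)^-1 *: submod_val y r] \in @sum_space L O v.
  apply/sum_spaceP=> r; rewrite ffunE; split=> rO.
    by apply: rpredZ; exact: (component_mem rO).
  by rewrite sum_sp_out // scaler0.
exists (fun y => SubMod (inv_mem y)) => y; apply/val_inj/ffunP=> r.
  rewrite /= ffunE; have [rO|nrO] := boolP (r \in O).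
    by rewrite cP // scalerA mulVf ?c0 // scale1r.
  by rewrite !sum_sp_out // scaler0.
have [rO|nrO] := boolP (r \in O).
  by rewrite /= cP //= ffunE scalerA mulfV ?c0 // scale1r.
by rewrite /= !sum_sp_out.
Qed.

Lemma orbit_root : r0 \in O.
Proof. by apply/gal_orbitP; exists 1%g; rewrite act1. Qed.

Lemma orbit_krep_not_zero : ~ rep_zero X.
Proof.
have [v [y y0]] := root_rep_nonzero L (ssvalP r0).
move=> /(_ v (inc orbit_root y)) E; apply: y0.
rewrite -[LHS](@sum_incK L _ _ orbit_root _) -[RHS](linear0 (sum_proj L orbit_root v)).
exact: (congr1 (sum_proj L orbit_root v) E).
Qed.

Lemma orbit_krep_indec : krep_indec X.
Proof. exact: krep_brick_indec orbit_krep_not_zero orbit_krep_brick. Qed.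

Lemma orbit_krep_corresponds : corresponds X O.
Proof.
exists (fun r => root_rep L (val r)); split=> [r _|]; last exact: sum_rep_iso.
exact/root_rep_the_indec/ssvalP.
Qed.

End Orbit.

Local Notation orb := (orbit ract 'Gal({:L} / 1)%g).
Local Notation X r := (orbit_krep (@gal_orbit_act r)).

(** A root summand of M over L gives L-linear maps to and from the orbit sum whose composite there
    is the projector onto one component, hence nonzero; [krep_brick_retract] applies. The base point
    [r'] is left free to match any choice of orbit representatives. *)
Lemma krep_indec_orbit (M : krep (D4_K iota)) :
  krep_indec M -> exists r, forall r', r \in orb r' -> krep_iso M (X r').
Proof.
move=> Mi; have [d dR [i [p pK]]] := root_summand_exists Mi.1.
exists (SeqSub dR) => r' rO; set r := SeqSub dR in rO.
pose u : rep_hom (X r') M := rep_comp i (sum_proj L rO).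
pose w : rep_hom M (X r') := rep_comp (sum_inc L rO) p.
apply: (krep_brick_retract (u := u) (w := w)) => //.
- exact: orbit_krep_brick.
- exact: orbit_krep_not_zero.
have [v [y y0]] := root_rep_nonzero L dR.
exists v, (sum_inc L rO v y) => E; apply: y0.
rewrite -[LHS]pK -[LHS](@sum_incK L _ _ rO _) -[RHS](linear0 (sum_proj L rO v)).
rewrite -[RHS](congr1 (sum_proj L rO v) E) /=.
rewrite -[in RHS](_ : y = component rO (inc rO y)) //.
exact/esym/(@sum_incK L _ _ rO v).
Qed.

(** Since b a is an invertible endomorphism, the first representation is a retract of the second, so
    they are isomorphic and share a dimension vector. *)
Lemma root_hom_nonzero_eq (r r' : posroot)
    (a : rep_hom (root_rep L (val r)) (root_rep L (val r')))
    (b : rep_hom (root_rep L (val r')) (root_rep L (val r))) :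
  nonzero_hom (rep_comp b a) -> r = r'.
Proof.
move=> /(root_rep_brick (ssvalP r))/rep_hom_inv[k kP].
apply/val_inj/esym; apply: has_dimvec_iso (root_rep_dimvec L (ssvalP r'))
  (root_rep_dimvec L (ssvalP r)).
apply: (indec_retract (i := a) (p := rep_comp k b)).
- by move=> v x; apply: (kP v).1.
- exact: root_rep_indec (ssvalP r').
- exact: root_rep_not_zero (ssvalP r).
Qed.

(** A Krull-Schmidt argument: the identity of the component at [r] is a sum of maps through the
    components of the second orbit, so one of them is nonzero and forces [r] into that orbit. *)
Lemma orbit_krep_iso r r' : krep_iso (X r) (X r') -> orb r = orb r'.
Proof.
move=> [f [g fg]]; have rO := orbit_root r.
have [v [y y0]] := root_rep_nonzero L (ssvalP r).
have [r1 r1O nz] : exists2 r1, r1 \in orb r' & r = r1.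
  apply: boolp.contrapT => nr; apply: y0.
  have gfy : g v (f v (sum_inc L rO v y)) = sum_inc L rO v y := (fg v).1 _.
  rewrite -[LHS](@sum_incK L _ _ rO v) -gfy.
  apply: (sum_decomp (f := sum_proj L rO v \o g v : {linear sum_sp L (orb r') v -> _})).
  move=> r1 r1O; apply: boolp.contrapT => nz; apply: nr; exists r1 => //.
  apply: (@root_hom_nonzero_eq r r1
    (rep_comp (sum_proj L r1O) (rep_comp f (sum_inc L rO)))
    (rep_comp (sum_proj L rO) (rep_comp g (sum_inc L r1O)))).
  by exists v, y.
by apply/eqP; rewrite orbit_eq_mem nz.
Qed.

End OrbitKRep.

(** * The orbits *)

Lemma tperm_of_sum_eq (d d' : 'I_3 -> nat) :
    (forall i, d i <= 1)%N -> (forall i, d' i <= 1)%N ->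
    (\sum_i d i = \sum_i d' i)%N ->
  exists i j, forall k, d' k = d (tperm i j k).
Proof.
move=> d1 d'1; rewrite !(sum_ord3 (V := nat)).
have swap i j k : (i != j -> k != i -> k != j ->
    d' i = d j -> d' j = d i -> d' k = d k ->
    exists i j, forall l, d' l = d (tperm i j l)).
  move=> ij ki kj di dj dk; exists i, j => l.
  case: tpermP => [->//|->//|/eqP li /eqP lj].
  have [->//|lk] := eqVneq l k.
  by have := ord3_third ij ki kj lk; rewrite (negPf li) (negPf lj).
have := (d1 0, d1 1, d1 2%:R, d'1 0, d'1 1, d'1 2%:R).
case d0: (d 0) => [|[|n0]]; case e1: (d 1) => [|[|n1]]; case e2: (d 2%:R) => [|[|n2]];
case d'0: (d' 0) => [|[|m0]]; case e'1: (d' 1) => [|[|m1]];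
case e'2: (d' 2%:R) => [|[|m2]];
  move=> [[[[[? ?] ?] ?] ?] ?] //= _;
  first [ by apply: (swap 0 1 2%:R); rewrite ?d0 ?e1 ?e2 ?d'0 ?e'1 ?e'2
        | by apply: (swap 0 2%:R 1); rewrite ?d0 ?e1 ?e2 ?d'0 ?e'1 ?e'2
        | by apply: (swap 1 2%:R 0); rewrite ?d0 ?e1 ?e2 ?d'0 ?e'1 ?e'2
        | by exists 0, 0 => k; rewrite tperm1 perm1; elim/ord3_ind: k;
             rewrite ?d0 ?e1 ?e2 ?d'0 ?e'1 ?e'2 ].
Qed.

(** A complete invariant of the orbits: leaf coordinates of a root are 0 or 1, so permuting the
    leaves preserves only how many are 1. *)
Definition orbit_type (d : dimvec D4) : nat * nat :=
  (d None, (\sum_i d (Some i))%N).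

Lemma orbit_typeD4 a b c e : orbit_type (D4vec a b c e) = (a, (b + c + e)%N).
Proof. by rewrite /orbit_type (sum_ord3 (V := nat)) !ffunE. Qed.

Section Orbits.
Variables (K : fieldType) (L : splittingFieldType K).
Variable iota : {morphism 'Gal({:L} / 1)%g >-> 'S_3}.
Hypothesis isoS3 : isom 'Gal({:L} / 1)%g [set: 'S_3] iota.

Local Notation orb := (orbit (posroot_act iota) 'Gal({:L} / 1)%g).

Lemma orbit_typeP (r r' : posroot) :
  reflect (orbit_type (val r) = orbit_type (val r')) (r' \in orb r).
Proof.
apply: (iffP (gal_orbitP iota r r')) => [[s <-]|].
  by rewrite /orbit_type posroot_act_center posroot_act_leaves.
have le1 (q : posroot) i : (val q (Some i) <= 1)%N.
  have : val q \in D4_posroots := ssvalP q; move: (val q) => d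
    /D4_posroots_cases[[j ->]|[_ //]|[_ ->//]].
  by rewrite ffunE; case: (_ == _).
move=> [c0 /(tperm_of_sum_eq (le1 r) (le1 r'))[i [j ij]]].
have : tperm i j \in (iota @* 'Gal({:L} / 1))%g.
  by rewrite (isom_im isoS3) inE.
(* Coordinates of a root move by the inverse, so [s^-1] realises precomposition with the
   transposition. *)
case/morphimP=> s _ _ sE; exists s^-1%g; apply/val_inj/ffunP=> -[k|].
  by rewrite posroot_actVE /= /D4_vactf /= -sE; exact/esym/ij.
by rewrite posroot_actVE.
Qed.

Definition orbit_rep_dim (i : 'I_6) : dimvec D4 :=
  nth (D4vec 0 0 0 0) [:: D4vec 1 0 0 0; D4vec 0 1 0 0; D4vec 1 1 0 0;
    D4vec 1 1 1 0; D4vec 1 1 1 1; D4vec 2 1 1 1] i.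

Lemma orbit_rep_dim_type i : orbit_type (orbit_rep_dim i) =
  nth (0, 0)%N [:: (1, 0); (0, 1); (1, 1); (1, 2); (1, 3); (2, 3)]%N i.
Proof.
by case: i => -[|[|[|[|[|[|//]]]]]] lti; rewrite /orbit_rep_dim /= orbit_typeD4.
Qed.

Lemma orbit_rep_dim_mem i : orbit_rep_dim i \in D4_posroots.
Proof.
by case: i => -[|[|[|[|[|[|//]]]]]] lti; rewrite !inE /= eqxx ?orbT.
Qed.

Definition orbit_repr i : posroot := SeqSub (orbit_rep_dim_mem i).

Lemma orbit_repr_inj : injective (fun i => orb (orbit_repr i)).
Proof.
move=> i j Eij; have : orbit_repr j \in orb (orbit_repr i).
  by rewrite Eij; apply: orbit_root.
move=> /orbit_typeP; rewrite !orbit_rep_dim_type => /eqP.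
rewrite nth_uniq ?ltn_ord // => /eqP; exact: val_inj.
Qed.

Lemma orbit_repr_exists (r : posroot) : exists i, r \in orb (orbit_repr i).
Proof.
have /(nthP (0, 0)%N)[i lti ri] : orbit_type (val r) \in
    [:: (1, 0); (0, 1); (1, 1); (1, 2); (1, 3); (2, 3)]%N.
  have : val r \in D4_posroots := ssvalP r; move: (val r) => d; rewrite !inE.
  by do 11?[case/orP]; move=> /eqP->; rewrite orbit_typeD4.
by exists (Ordinal lti); apply/orbit_typeP; rewrite orbit_rep_dim_type.
Qed.

Lemma root_orbits_repr : root_orbits iota = [set orb (orbit_repr i) | i : 'I_6].
Proof.
apply/setP=> A; apply/imsetP/imsetP => -[r _ ->].
  have [i ri] := orbit_repr_exists r; exists i => //.
  by apply/eqP; rewrite orbit_eq_mem.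
by exists (orbit_repr r).
Qed.

End Orbits.

Lemma card_posroot : #|{: posroot}| = 12%N.
Proof.
have D4vec_inj : injective (fun q : nat * nat * nat * nat =>
    D4vec q.1.1.1 q.1.1.2 q.1.2 q.2).
  move=> [[[a b] c] e] [[[a' b'] c'] e'] /ffunP E.
  have := (E None, E (Some 0), E (Some 1), E (Some 2%:R)).
  by rewrite !ffunE /= => -[[[-> ->] ->] ->].
rewrite card_seq_sub //.
(* Distinctness is decided by computation on quadruples of numbers rather than on finite
   functions. *)
rewrite -[D4_posroots]/(map (fun q : nat * nat * nat * nat =>
    D4vec q.1.1.1 q.1.1.2 q.1.2 q.2)
  [:: (1, 0, 0, 0); (0, 1, 0, 0); (0, 0, 1, 0); (0, 0, 0, 1);
      (1, 1, 0, 0); (1, 0, 1, 0); (1, 0, 0, 1);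
      (1, 1, 1, 0); (1, 1, 0, 1); (1, 0, 1, 1); (1, 1, 1, 1); (2, 1, 1, 1)]%N).
by rewrite map_inj_uniq.
Qed.

Local Close Scope ring_scope.

Theorem theorem3p1 (K : fieldType) (L : splittingFieldType K)
    (char0 : [pchar K]%R =i pred0)
    (galL : galois 1 {:L})
    (iota : {morphism 'Gal({:L} / 1)%g >-> 'S_3})
    (isoS3 : isom 'Gal({:L} / 1)%g [set: 'S_3] iota) :
  #|{: posroot}| = 12 /\
  #|root_orbits iota| = 6 /\
  exists (X : 'I_6 -> krep (D4_K iota)) (O : 'I_6 -> {set posroot}),
    [/\ forall i, krep_indec (X i),
        forall i j, krep_iso (X i) (X j) -> i = j,
        forall M : krep (D4_K iota), krep_indec M ->
          exists i, krep_iso M (X i),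
        injective O /\ root_orbits iota = [set O i | i : 'I_6]
      & forall i, corresponds (X i) (O i)].
Proof.
have O_inj := orbit_repr_inj isoS3; have OE := root_orbits_repr isoS3.
split; first exact: card_posroot.
split; first by rewrite OE card_imset // card_ord.
pose r_ i := orbit_repr i.
exists (fun i => orbit_krep (@gal_orbit_act _ _ iota (r_ i))),
  (fun i => orbit (posroot_act iota) 'Gal({:L} / 1)%g (r_ i)).
split=> [i|i j /orbit_krep_iso|M /krep_indec_orbit[r Mr]|//|i].
- exact: orbit_krep_indec.
- exact: O_inj.
- have [i ri] := orbit_repr_exists isoS3 r; exists i; exact: Mr.
- exact: orbit_krep_corresponds.
Qed.
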